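(* Let $n\ge3$, $d\ge2$, $\ell\ge2$. If $2\ell\le n$, then $$\dim\sigma_\ell(\mathbb X_{n-1,d})=\dim\sigma_\ell(\mathbb X_{n-1,[d-1,1]}).$$ Moreover, $\sigma_\ell(\mathbb X_{n-1,d})$ is defective if and only if it does not fill its ambient space.
   Context: Let $\mathbb K$ be an algebraically closed field of characteristic zero and $S=\mathbb K[x_1,\ldots,x_n]=\bigoplus_{i\ge0}[S]_i$ the standard graded polynomial ring. Put $N=\binom{d+n-1}{n-1}$. For $1\le k\le\lfloor d/2\rfloor$ let $$\mathbb X_{n-1,[d-k,k]}=\{[F]\in\mathbb P([S]_d)=\mathbb P^{N-1}\mid F=F_1F_2,\ 0\ne F_1\in[S]_{d-k},\ 0\neq F_2\in[S]_k\}.$$ The variety of reducible forms of degree $d$ in $n$ variables is the (in general reducible) variety $$\mathbb X_{n-1,d}=\bigcup_{k=1}^{\lfloor d/2\rfloor}\mathbb X_{n-1,[d-k,k]}\subset\mathbb P^{N-1}.$$ For a (possibly reducible) variety $\mathbb X\subset\mathbb P^{N-1}$, $\sigma_\ell(\mathbb X)$ denotes the Zariski closure of the union of the linear spans of all subsets of $\ell$ distinct points of $\mathbb X$ (and $\mathbb P^{N-1}$ if $\ell\ge N$). It fills its ambient space if it equals $\mathbb P^{N-1}$. Its expected dimension is $\min\{N-1,\ \ell\cdot\dim\mathbb X+\ell-1\}$, and it is defective if its dimension is strictly less than the expected dimension. *)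

(* Defs.v *)
From mathcomp Require Import all_boot all_order all_algebra.
From mathcomp Require Import classical_sets.
From mathcomp Require Import mpoly.

Set Implicit Arguments.
Unset Strict Implicit.
Unset Printing Implicit Defensive.

Import GRing.Theory.

Local Open Scope ring_scope.
Local Open Scope classical_set_scope.

Section ProjectiveSpace.
Context (K : fieldType) (V : vectType K).

(* The projective space P(V), whose points are the lines of V. *)
Definition proj : Type := {L : {vspace V} | \dim L == 1%N}.

Definition vcoords (v : V) : 'I_(\dim {:V}) -> K :=
  fun i => coord (vbasis {:V}) i v.

(* For homogeneous P this does not depend on the representative; letting v
   range over the whole line, 0 included, changes nothing, as a homogeneous
   polynomial vanishes at 0 unless it is a nonzero constant. *)
Definition vanishes_at (P : {mpoly K[\dim {:V}]}) (q : proj) : Prop :=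
  forall v : V, v \in val q -> P.@[vcoords v] = 0.

Definition zclosed (Z : set proj) : Prop :=
  exists2 S : set {mpoly K[\dim {:V}]},
    (forall P, S P -> exists e : nat, P \is e.-homog) &
    Z = [set q | forall P, S P -> vanishes_at P q].

Definition zclosure (Y : set proj) : set proj :=
  \bigcap_(Z in [set Z | zclosed Z /\ Y `<=` Z]) Z.

Definition zirreducible (Z : set proj) : Prop :=
  Z !=set0 /\
  forall C D : set proj, zclosed C -> zclosed D ->
    Z `<=` C `|` D -> Z `<=` C \/ Z `<=` D.

(* Z 0, ..., Z m is a strictly increasing chain of irreducible closed subsets
   of Y, for the topology induced on Y. *)
Definition irred_chain (Y : set proj) (m : nat) (Z : nat -> set proj) : Prop :=
  (forall i, (i <= m)%N ->
     zirreducible (Z i) /\ exists2 C, zclosed C & Z i = Y `&` C) /\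
  (forall i, (i < m)%N -> Z i `<` Z i.+1).

(* Krull dimension: the largest length of such a chain. *)
Definition has_dim (Y : set proj) (m : nat) : Prop :=
  (exists Z, irred_chain Y m Z) /\
  (forall k Z, irred_chain Y k Z -> (k <= m)%N).

Definition lin_spans (l : nat) (X : set proj) : set proj :=
  [set q | exists p : 'I_l -> proj,
     [/\ injective p, forall i, X (p i)
       & (val q <= \sum_(i < l) val (p i))%VS]].

Definition secant (l : nat) (X : set proj) : set proj :=
  if (\dim {:V} <= l)%N then setT else zclosure (lin_spans l X).

(* With dim P(V) = \dim {:V} - 1 and e = dim X. *)
Definition expected_dim (l e : nat) : nat :=
  minn (\dim {:V}).-1 (l * e + l)%N.-1.

Definition secant_defective (l : nat) (X : set proj) : Prop :=
  exists e s : nat,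
    [/\ has_dim X e, has_dim (secant l X) s & (s < expected_dim l e)%N].

End ProjectiveSpace.

(* [S]_d for S = K[x_0, ..., x_r], a polynomial ring in r + 1 variables. *)
Notation forms K r d := (dhomog r.+1 K d).

Lemma dim_forms (K : fieldType) (r d : nat) :
  \dim {:forms K r d} = 'C(d + r, r)%N.
Proof. by rewrite dimvf /= -[RHS]bin_sub ?leq_addl // addnK. Qed.

(* X_{r,[d-k,k]}, a subset of P([S]_d). *)
Definition reducible_type (K : fieldType) (r d k : nat) :
    set (proj (forms K r d)) :=
  [set q | exists (F1 : forms K r (d - k)%N) (F2 : forms K r k) (F : forms K r d),
     [/\ F1 != 0, F2 != 0,
         mpoly_of_dhomog F = mpoly_of_dhomog F1 * mpoly_of_dhomog F2
       & val q = <[F]>%VS]].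

(* X_{r,d} *)
Definition reducible_forms (K : fieldType) (r d : nat) :
    set (proj (forms K r d)) :=
  \bigcup_(k in [set k : nat | (1 <= k <= d./2)%N]) @reducible_type K r d k.

Arguments reducible_type K r d k : clear implicits.
Arguments reducible_forms K r d : clear implicits.

(* Main.v *)
(* The points of a fixed type lying on the secant variety are the values of a
   quadratic map [u |-> B(u, u)], namely [(F_i, G_i) |-> sum_i F_i G_i], so its
   dimension is governed by the rank of the derivative
   [v |-> B(u, v) + B(v, u)], whose image is the degree [d] part of the ideal
   [(F_1, G_1, ..., F_l, G_l)] (Terracini).

   Upper bound.  At a point [a] where the derivative has maximal rank [rho],
   choose a linear subspace [W] of dimension [rho] through [a] on which it is
   injective.  In characteristic 0 a form vanishing on the image of [W] vanishes
   on the whole image, since to first order every direction transverse to [W] is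
   tangent to the image of [W].  On the other hand, a chain
   [Z_0 < ... < Z_k] of irreducible closed subsets yields forms [f_i] of one
   degree [D], with [f_i] zero on [Z_(i-1)] but not on [Z_i], whose monomials are
   independent on [Z_k].  Comparing the number of monomials of degree [e] in
   [k + 1] variables with the number of forms of degree [2 D e] in [rho]
   variables gives [k < rho].

   Lower bound.  The images of the members of a flag of subspaces through [a]
   have strictly increasing closures, by the Jacobian criterion.

   Ranks.  A deformation to [F_i = x_(2i)^(d-k_i)], [G_i = x_(2i+1)^(k_i)]
   shows that, for [2 l <= n], the rank is at most its value at this monomial
   complete intersection, and this value is largest when all [k_i = 1].
   For arbitrary [l >= 2], the rank is smaller than [l (dim X + 1)], because of
   the Koszul relation between two linear factors when all [k_i = 1], and because
   the other types have smaller dimension.  Hence a secant variety that does not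
   fill its ambient space is defective. *)
From HB Require Import structures.
Require Import Defs.
From mathcomp Require Import all_boot all_order all_algebra.
From mathcomp Require Import boolp classical_sets mpoly zify.

Set Implicit Arguments.
Unset Strict Implicit.
Unset Printing Implicit Defensive.

Import GRing.Theory.

(** * Polynomials over an infinite field *)

Section Nonroots.
Local Open Scope ring_scope.
Context (K : fieldType) (charK0 : [pchar K] =i pred0).

Lemma natr_neq0 (n : nat) : ((n.+1)%:R : K) != 0.
Proof. by move/pcharf0P: charK0 => ->. Qed.

Lemma natr_inj_pchar0 : injective (fun n : nat => n%:R : K).
Proof.
move=> m n /eqP; wlog le_mn : m n / (m <= n)%N.
  by move=> wl; case/orP: (leq_total m n) => [|le_nm]; first exact: wl;
    rewrite eq_sym => /wl->.
rewrite eq_sym -subr_eq0 -natrB //.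
move/pcharf0P: charK0 => -> /eqP/eqP; rewrite subn_eq0 => le_nm.
by apply/eqP; rewrite eqn_leq le_mn.
Qed.

Lemma poly_nonroot (p : {poly K}) : p != 0 -> exists s, p.[s] != 0.
Proof.
move=> p0; apply: contrapT => h.
(* The distinct elements [0, 1, ..., size p - 1] cannot all be roots of [p]. *)
pose rs := [seq (i%:R : K) | i <- iota 0 (size p)].
suff: (size rs < size p)%N by rewrite size_map size_iota ltnn.
apply: max_poly_roots => //.
  apply/allP=> s _; apply/eqP; apply: contrapT => /eqP hs.
  by apply: h; exists s.
by rewrite map_inj_uniq ?iota_uniq //; apply: natr_inj_pchar0.
Qed.

Definition mnm_restrict n (m : 'X_{1..n.+1}) : 'X_{1..n} :=
  [multinom m (widen_ord (leqnSn n) i) | i < n].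

Lemma mnm_restrict_inj n (m m' : 'X_{1..n.+1}) :
  m ord_max = m' ord_max -> mnm_restrict m = mnm_restrict m' -> m = m'.
Proof.
move=> e /mnmP e'; apply/mnmP=> i; case: (unliftP ord_max i) => [j|] -> //.
have := e' j; rewrite !mnmE (_ : widen_ord _ j = lift ord_max j) //.
exact/val_inj/esym/lift_max.
Qed.

(** [muni] singles out the last variable; since it loses no coefficient, questions about several
    variables reduce to one variable over the remaining ones. *)
Lemma mcoeff_muni n (p : {mpoly K[n.+1]}) m :
  ((muni p)`_(m ord_max))@_(mnm_restrict m) = p@_m.
Proof.
have h m' : ((p@_m' *: 'X_[mnm_restrict m'] *: 'X^(m' ord_max))`_(m ord_max))@_(mnm_restrict m)
    = p@_m' * (m' == m)%:R.
  rewrite coefZ coefXn; have [->|ne] := eqVneq m' m.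
    by rewrite eqxx !mulr1 mcoeffZ mcoeffX eqxx mulr1.
  case: eqP => [e|_]; last by rewrite !mulr0 mcoeff0.
  rewrite mulr1 mcoeffZ mcoeffX; case: eqP => // e'.
  by case/eqP: ne; apply: mnm_restrict_inj.
rewrite muniE coef_sum raddf_sum /=; under eq_bigr do rewrite h.
have [mp|mp] := boolP (m \in msupp p).
  rewrite (bigD1_seq m) //= eqxx mulr1 big1 ?addr0 // => m' /negPf->.
  by rewrite mulr0.
rewrite (memN_msupp_eq0 mp) big1_seq // => m' /= m'p.
by case: eqP => [e|_]; [rewrite -e m'p in mp | rewrite mulr0].
Qed.

Lemma muni_eq0 n (p : {mpoly K[n.+1]}) : muni p = 0 -> p = 0.
Proof. by move=> p0; apply/mpolyP=> m; rewrite -mcoeff_muni p0 coef0 !mcoeff0. Qed.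

(** Appends [s] as the last coordinate: [insub] fails exactly at the index [n]. *)
Definition extend_point n (t : 'I_n -> K) (s : K) : 'I_n.+1 -> K :=
  fun i => oapp t s (insub (i : nat)).

Lemma extend_point_widen n (t : 'I_n -> K) s i :
  extend_point t s (widen_ord (leqnSn n) i) = t i.
Proof.
rewrite /extend_point (insubT (fun i => i < n)%N (ltn_ord i)) /=.
by congr t; apply: val_inj.
Qed.

Lemma extend_point_max n (t : 'I_n -> K) s : extend_point t s ord_max = s.
Proof. by rewrite /extend_point insubF ?ltnn. Qed.

Lemma meval_muni n (p : {mpoly K[n.+1]}) t s :
  (map_poly (meval t) (muni p)).[s] = p.@[extend_point t s].
Proof.
rewrite muniE mevalE rmorph_sum horner_sum; apply: eq_bigr => m _.
rewrite -mul_polyC rmorphM /= map_polyC /= map_polyXn.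
rewrite hornerCM hornerXn mevalZ mevalX big_ord_recr /= -mulrA extend_point_max.
by under [in RHS]eq_bigr do rewrite extend_point_widen; under eq_bigr do rewrite mnmE.
Qed.

(** By induction the leading coefficient in the last variable is nonzero at some point; specialising
    there leaves a nonzero univariate polynomial. *)
Lemma mpoly_nonroot n (p : {mpoly K[n]}) : p != 0 -> exists v, p.@[v] != 0.
Proof.
elim: n p => [|n IHn] p p0.
  exists (fun=> 0); rewrite [p]nvar0_mpolyC mevalC.
  by apply: contraNneq p0; rewrite [p in _ -> p == 0]nvar0_mpolyC => ->.
have : lead_coef (muni p) != 0.
  by rewrite lead_coef_eq0; apply: contraNneq p0 => /muni_eq0->.
move=> /IHn[v vq]; have r0 : map_poly (meval v) (muni p) != 0.
  apply: contraNneq vq => /(congr1 (fun r : {poly K} => r`_(size (muni p)).-1)).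
  by rewrite coef_map coef0 => /= ->.
by have [s] := poly_nonroot r0; rewrite meval_muni; exists (extend_point v s).
Qed.

Lemma mpoly_eq0P n (p : {mpoly K[n]}) : (forall v, p.@[v] = 0) -> p = 0.
Proof.
move=> h; apply/eqP; apply: contrapT => /negP /mpoly_nonroot[v].
by rewrite h eqxx.
Qed.

(** * Partial derivatives and vanishing along a hyperplane *)

Lemma muniX n (m : 'X_{1..n.+1}) :
  muni 'X_[K, m] = 'X_[mnm_restrict m] *: 'X^(m ord_max).
Proof. by rewrite muniE msuppX big_seq1 mcoeffX eqxx scale1r. Qed.

Lemma muni_mderiv_max n (p : {mpoly K[n.+1]}) :
  muni p^`M(ord_max) = (muni p)^`().
Proof.
elim/mpolyind: p => [|c m p _ _ IH]; first by rewrite !raddf0.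
rewrite mderivD mderivZ !muniD !muniZ derivD derivZ IH; congr (_ *: _ + _).
rewrite mderivX muniZ !muniX derivZ derivXn mnmBE mnm1E eqxx subn1.
rewrite scalerA mul_mpolyC scaler_nat -scalerMnl -scalerMnr.
congr (_ *: _ *+ _); congr ('X_[_]); apply/mnmP=> i.
rewrite !mnmE (_ : (ord_max == _) = false) ?subn0 //.
by apply/eqP => /(congr1 val) /= e; have := ltn_ord i; rewrite -e ltnn.
Qed.

Lemma muni_mderiv_widen n (p : {mpoly K[n.+1]}) i :
  muni p^`M(widen_ord (leqnSn n) i) = map_poly (mderiv i) (muni p).
Proof.
elim/mpolyind: p => [|c m p _ _ IH]; first by rewrite !raddf0.
rewrite mderivD mderivZ !muniD !muniZ raddfD /= IH; congr (_ + _).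
rewrite mderivX muniZ !muniX; apply/polyP=> k.
rewrite coef_map /= !coefZ !coefXn mnmBE mnm1E.
rewrite (_ : (widen_ord _ i == ord_max) = false) ?subn0; last first.
  by apply/eqP => /(congr1 val) /= e; have := ltn_ord i; rewrite e ltnn.
rewrite mderiv_mulC; congr (_ * _); case: eqP => _; rewrite ?mulr0 ?raddf0 // !mulr1.
rewrite mderivX mul_mpolyC mnmE; congr (_ *: 'X_[_]); apply/mnmP=> j.
by rewrite !(mnmE, mnmBE, mnm1E).
Qed.

(** If [g = H 'X^(k+1)], the derivatives along the hyperplane keep the factor ['X^(k+1)], while the
    transversal one only keeps ['X^k]. Cancelling ['X^k] and evaluating at 0 leaves the transversal
    term. *)
Lemma leading_term_eq0 (R : idomainType) (A C H : {poly R}) k : ~~ root H 0 ->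
  (A * 'X + C * (H^`() * 'X + H *+ k.+1)) * 'X^k = 0 ->
  (forall x : R, x *+ k.+1 = 0 -> x = 0) -> C.[0] = 0.
Proof.
move=> H0 /eqP; rewrite mulf_eq0 expf_eq0 polyX_eq0 andbF orbF.
move=> /eqP/(congr1 (horner^~ 0)); rewrite hornerD hornerMX mulr0 add0r horner0.
rewrite hornerM hornerD hornerMX mulr0 add0r hornerMn mulrnAr => + h.
by move/h/eqP; rewrite mulf_eq0 -/(root H 0) (negPf H0) orbF => /eqP.
Qed.

(* With [k] the order of vanishing of [g] along the hyperplane, the transversal
   derivative vanishes to order exactly [k - 1] in characteristic 0, and the
   tangential ones to order at least [k]. *)
Lemma transversal_relation_eq0 n (g : {mpoly K[n.+1]}) (C : 'I_n.+1 -> {mpoly K[n.+1]}) :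
  \sum_i C i * g^`M(i) = 0 ->
  (forall t, g.@[extend_point t 0] = 0) ->
  (exists t, (C ord_max).@[extend_point t 0] != 0) -> g = 0.
Proof.
move=> rel g0 [t0 Ct0]; apply: muni_eq0; apply/eqP; apply: contrapT => /negP G0.
have [[|k] [H]] := multiplicity_XsubC (muni g) 0; rewrite polyC0 subr0 G0 /= => H0 GE.
  (* Multiplicity zero is impossible, since [g] vanishes on the hyperplane. *)
  case/negP: H0; rewrite mulr1 in GE; rewrite -GE /root; apply/eqP/mpoly_eq0P => t.
  by rewrite -[RHS](g0 t) -meval_muni -[X in _ = _.[X]](meval0 t) horner_map.
have := congr1 (@muni n K) rel; rewrite muni0 raddf_sum big_ord_recr /= => rel'.
pose R := \sum_(i < n) muni (C (widen_ord (leqnSn n) i)) * map_poly (mderiv i) H.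
have : (R * 'X + muni (C ord_max) * (H^`() * 'X + H *+ k.+1)) * 'X^k = 0.
  rewrite -[RHS]rel' mulrDl; congr (_ + _).
    rewrite -mulrA -exprS mulr_suml; apply: eq_bigr => i _.
    rewrite muniM muni_mderiv_widen GE -mulrA; congr (_ * _).
    apply/polyP => j; rewrite coefMXn !coef_map /= coefMXn.
    by case: ifP => // _; rewrite raddf0.
  rewrite muniM muni_mderiv_max GE derivM derivXn /= -mulrA mulrDl; congr (_ * (_ + _)).
    by rewrite -mulrA -exprS.
  by rewrite mulrnAl mulrnAr.
move=> /(leading_term_eq0 (H := H) H0) C0.
case/eqP: Ct0; rewrite -meval_muni -[X in _.[X]](meval0 t0) horner_map /=.
rewrite C0 ?meval0 // => x /eqP.
by rewrite -mulr_natr mulf_eq0 -mpolyC_nat mpolyC_eq0 (negPf (natr_neq0 _)) orbF => /eqP.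
Qed.

(** Chain rule: the identity is stable under products and linear combinations, so it suffices to
    check it on variables. *)
Lemma mderiv_comp n k (P : {mpoly K[n]}) (F : n.-tuple {mpoly K[k]}) i :
  (P \mPo F)^`M(i) = \sum_c (P^`M(c) \mPo F) * (tnth F c)^`M(i).
Proof.
pose S (Q : {mpoly K[n]}) := (Q \mPo F)^`M(i) = \sum_c (Q^`M(c) \mPo F) * (tnth F c)^`M(i).
have SM Q1 Q2 : S Q1 -> S Q2 -> S (Q1 * Q2).
  rewrite /S rmorphM mderivM => -> ->; rewrite mulr_suml mulr_sumr -big_split.
  apply: eq_bigr => c _; rewrite mderivM rmorphD !rmorphM /= mulrDl.
  by rewrite mulrA [X in X + _]mulrAC.
have S1 : S 1.
  rewrite /S rmorph1 -!mpolyC1 mderivC big1 // => c _.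
  by rewrite mderivC raddf0 mul0r.
have SX j : S 'X_j.
  rewrite /S comp_mpolyXU -tnth_nth (bigD1 j) //= big1 ?addr0 => [|c cj].
    by rewrite mderivX mnm1E eqxx scale1r -{1}[U_(j)%MM]add0m addmK mpolyX0 rmorph1 mul1r.
  by rewrite mderivX mnm1E eq_sym (negPf cj) scale0r raddf0 mul0r.
have Spow Q j : S Q -> S (Q ^+ j).
  move=> SQ; elim: j => [|j IH]; first by rewrite expr0.
  by rewrite exprS; apply: SM.
elim/mpolyind: P => [|c m p _ _ IH].
  by rewrite !raddf0 big1 // => c _; rewrite !raddf0 mul0r.
rewrite comp_mpolyD mderivD IH comp_mpolyZ mderivZ.
under [RHS]eq_bigr do rewrite mderivD mderivZ comp_mpolyD comp_mpolyZ mulrDl -scalerAl.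
rewrite [RHS]big_split -scaler_sumr; congr (_ *: _ + _).
rewrite -/(S _) mpolyXE_id; apply: (big_ind S S1 SM) => j _.
exact/Spow/SX.
Qed.

(** * Homogeneous polynomials and growth of their number *)

Lemma dhomog_scale n e (P : {mpoly K[n]}) (c : K) v :
  P \is e.-homog -> P.@[fun i => c * v i] = c ^+ e * P.@[v].
Proof.
move=> /dhomogP hP; rewrite !mevalE mulr_sumr.
apply: eq_big_seq => m mP; rewrite mulrCA; congr (_ * _).
rewrite -(hP _ mP) /= mdegE -prodrXr -big_split.
by apply: eq_bigr => i _; rewrite exprMn.
Qed.

Lemma dhomog_comp n k e d (P : {mpoly K[n]}) (F : n.-tuple {mpoly K[k]}) :
  P \is e.-homog -> (forall i, tnth F i \is d.-homog) ->
  P \mPo F \is (d * e).-homog.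
Proof.
move=> /dhomogP hP hF; rewrite comp_mpolyEX big_seq.
apply: rpred_sum => m mP; apply: rpredZ; rewrite comp_mpolyX.
rewrite -(hP _ mP) /= mdegE big_distrr /=.
elim/big_ind2: _ => [|????|i _]; [exact: dhomog1 | exact: dhomogM|].
exact: dhomogMn.
Qed.

Lemma dhomog_mderiv n e (P : {mpoly K[n]}) i :
  P \is e.+1.-homog -> P^`M(i) \is e.-homog.
Proof.
move=> hP; apply/dhomogP => m; rewrite mcoeff_msupp mcoeff_mderiv.
apply: contraNeq => hm; apply/eqP.
rewrite (dhomog_nemf_coeff hP) ?mul0rn //=.
by rewrite mdegD mdeg1 addn1 eqSS.
Qed.

(** A monomial of positive degree contains some variable; differentiating along it multiplies its
    coefficient by a positive integer, nonzero in characteristic 0. *)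
Lemma mderiv0_dhomog n e (P : {mpoly K[n]}) :
  P \is e.+1.-homog -> (forall i, P^`M(i) = 0) -> P = 0.
Proof.
move=> /dhomogP hP h; apply/eqP; rewrite -msupp_eq0.
case E: (msupp P) => [//|m s]; exfalso.
have mP : m \in msupp P by rewrite E mem_head.
have /hP /= dm := mP.
have [i mi] : exists i, m i != 0%N.
  apply: contrapT => h'; suff m0 : m = 0%MM by move: dm; rewrite m0 mdeg0.
  apply/mnmP=> i; rewrite mnm0E; apply/eqP; apply: contrapT => mi.
  by apply: h'; exists i; apply/negP.
have := h i => /(congr1 (mcoeff (m - U_(i))%MM)) /eqP.
rewrite mcoeff_mderiv mcoeff0 submK ?lep1mP //.
rewrite -mulr_natr mulf_eq0 (negPf (natr_neq0 _)) orbF.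
by apply/negP; rewrite -mcoeff_msupp.
Qed.

(* The left-hand side grows like the [r]-th power of [e], the right-hand side
   like its [r.+1]-st power. *)
Lemma bin_growth (c r : nat) : exists e, ('C(c * e + r, r) < 'C(e + r.+1, r.+1))%N.
Proof.
(* For [e = (r+1) t] the left side is at most [(a t)^r] and the right side at least [t^(r+1)], so
   any [t > a^r] works. *)
pose a := (c * r.+1 + r)%N; pose t := (a ^ r).+1; exists (r.+1 * t)%N.
have low s x : (x ^ s <= (x + s) ^_ s)%N.
  elim: s x => [|s IH] x; first by rewrite ffactn0.
  by rewrite addnS ffactSS expnS leq_mul // ltnW // ltnS leq_addr.
have up s x : (x ^_ s <= x ^ s)%N.
  elim: s => [|s IH]; first by rewrite ffactn0.
  by rewrite ffactnSr expnSr leq_mul ?leq_subr.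
have h1 : ('C(c * (r.+1 * t) + r, r) <= (a * t) ^ r)%N.
  apply: (@leq_trans ((c * (r.+1 * t) + r) ^ r)%N).
    by rewrite (leq_trans _ (up _ _)) // -bin_ffact leq_pmulr ?fact_gt0.
  have [->//|r0] := posnP r; rewrite leq_exp2r // /a mulnDl mulnA leq_add2l.
  by rewrite leq_pmulr.
have h2 : (t ^ r.+1 <= 'C(r.+1 * t + r.+1, r.+1))%N.
  rewrite -(leq_pmul2r (fact_gt0 r.+1)) bin_ffact (leq_trans _ (low _ _)) //.
  rewrite expnMn mulnC leq_mul2r orbC (leq_trans _ (up _ _)) //.
  by rewrite ffactnn.
apply: (leq_ltn_trans h1); apply: leq_trans h2.
by rewrite expnMn expnS ltn_mul2r expn_gt0 /= ltnSn.
Qed.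

End Nonroots.

(** * Vanishing of forms and chains of irreducible sets *)

Section ProjectiveGeometry.
Local Open Scope ring_scope.
Local Open Scope classical_set_scope.
Context (K : fieldType) (V : vectType K).
Local Notation N := (\dim {:V}).
Implicit Types (P Q : {mpoly K[N]}) (v : V) (q : proj V) (Z Y : set (proj V)).

Lemma pt_subproof v : v != 0 -> \dim <[v]>%VS == 1%N.
Proof. by rewrite dim_vline => ->. Qed.

Definition pt v (v0 : v != 0) : proj V := exist _ <[v]>%VS (pt_subproof v0).

Lemma ptP q : exists v (v0 : v != 0), q = pt v0.
Proof.
case: q => L dL; have v0 : vpick L != 0 by rewrite vpick0 -dimv_eq0 (eqP dL).
exists (vpick L), v0; apply: val_inj; apply/esym/eqP.
by rewrite /= eqEdim -memvE memv_pick (eqP dL) dim_vline v0.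
Qed.

Lemma vcoordsZ c v i : vcoords (c *: v) i = c * vcoords v i.
Proof. by rewrite /vcoords linearZ. Qed.

Lemma vcoords_eq0 v : (forall c, vcoords v c = 0) -> v = 0.
Proof.
move=> h; rewrite (coord_vbasis (memvf v)); apply: big1 => c _.
by rewrite [coord _ _ _](h c) scale0r.
Qed.

Lemma vcoords_neq0 v : v != 0 -> exists c, vcoords v c != 0.
Proof.
move=> v0; apply: contrapT => h; move/negP: v0; apply; apply/eqP/vcoords_eq0 => c.
by apply/eqP; apply: contrapT => hc; apply: h; exists c; apply/negP.
Qed.

Lemma vanishes_ptE e P v (v0 : v != 0) :
  P \is e.-homog -> vanishes_at P (pt v0) <-> P.@[vcoords v] = 0.
Proof.
move=> hP; split=> [/(_ v (memv_line v))//|h w /= /vlineP[c ->]].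
rewrite (meval_eq (v2 := fun i => c * vcoords v i)) => [|i]; last exact: vcoordsZ.
by rewrite (dhomog_scale c _ hP) h mulr0.
Qed.

Definition vanish_on P Z := forall q, Z q -> vanishes_at P q.

Lemma vanish_onS P Z Y : Z `<=` Y -> vanish_on P Y -> vanish_on P Z.
Proof. by move=> sZY h q /sZY /h. Qed.

Lemma zclosed_vanishes e P : P \is e.-homog -> zclosed [set q | vanishes_at P q].
Proof.
move=> hP; exists [set P]; first by move=> _ ->; exists e.
by apply/seteqP; split=> q /= h; [move=> _ -> | apply: h].
Qed.

Lemma vanish_onM P Q Z : vanish_on P Z -> vanish_on (P * Q) Z.
Proof. by move=> h q /h hq v /hq; rewrite mevalM => ->; rewrite mul0r. Qed.

(** The forms vanishing on an irreducible set generate a prime ideal; closedness of the zero sets of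
    [P] and [Q] is all that irreducibility asks for. *)
Lemma zirreducible_prime e f P Q Z : zirreducible Z ->
  P \is e.-homog -> Q \is f.-homog ->
  vanish_on (P * Q) Z -> vanish_on P Z \/ vanish_on Q Z.
Proof.
move=> [_ irr] hP hQ h.
case: (irr _ _ (zclosed_vanishes hP) (zclosed_vanishes hQ)) => [q Zq||]; [|by left|by right].
have [v [v0 eq]] := ptP q; move: (h q Zq); rewrite eq.
move/(vanishes_ptE v0 (dhomogM hP hQ))/eqP; rewrite mevalM mulf_eq0 => /orP[]/eqP ?.
  by left; apply/(vanishes_ptE v0 hP).
by right; apply/(vanishes_ptE v0 hQ).
Qed.

Lemma vanish_on_const c Z : Z !=set0 -> vanish_on c%:MP Z -> c = 0.
Proof.
move=> [q Zq] /(_ q Zq); have [v [v0 ->]] := ptP q.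
have h0 : (c%:MP : {mpoly K[N]}) \is 0.-homog.
  by rewrite -[c%:MP]mulr1 mul_mpolyC rpredZ // dhomog1.
by move/(vanishes_ptE v0 h0); rewrite mevalC.
Qed.

Lemma zirreducible_exp e P k Z : zirreducible Z -> P \is e.-homog ->
  vanish_on (P ^+ k) Z -> vanish_on P Z.
Proof.
move=> irr hP; elim: k => [|k IH].
  rewrite expr0 -mpolyC1 => h1; case: irr => ne _.
  by have /eqP := vanish_on_const ne h1; rewrite oner_eq0.
rewrite exprS => /(zirreducible_prime irr hP (dhomogMn _ hP)) [//|]; exact: IH.
Qed.

Lemma dhomog_prod_ex (I : eqType) (s : seq I) (P : I -> {mpoly K[N]}) :
  (forall i, exists e, P i \is e.-homog) -> exists e, \prod_(i <- s) P i \is e.-homog.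
Proof.
move=> hP; elim: s => [|i s [e IH]]; first by exists 0%N; rewrite big_nil; apply: dhomog1.
by have [f hf] := hP i; exists (f + e)%N; rewrite big_cons; apply: dhomogM.
Qed.

Lemma zirreducible_prod (I : eqType) (s : seq I) (P : I -> {mpoly K[N]}) Z :
  zirreducible Z -> (forall i, exists e, P i \is e.-homog) ->
  vanish_on (\prod_(i <- s) P i) Z -> exists2 i, i \in s & vanish_on (P i) Z.
Proof.
move=> irr hP; elim: s => [|i s IH].
  rewrite big_nil -mpolyC1 => h1; case: irr => ne _.
  by have /eqP := vanish_on_const ne h1; rewrite oner_eq0.
have [f hf] := hP i; have [e he] := dhomog_prod_ex s hP.
rewrite big_cons => /(zirreducible_prime irr hf he) [|/IH[j js]].
  by exists i; rewrite ?mem_head.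
by exists j; rewrite // in_cons js orbT.
Qed.

Lemma zclosure_sub Y : Y `<=` zclosure Y.
Proof. by move=> q Yq Z [_]; apply. Qed.

Lemma zclosure_min Y Z : zclosed Z -> Y `<=` Z -> zclosure Y `<=` Z.
Proof. by move=> cZ sYZ q; apply; split. Qed.

Lemma zclosureS Y Z : Y `<=` Z -> zclosure Y `<=` zclosure Z.
Proof. by move=> sYZ q hq W [cW sZW]; apply: hq; split=> //; apply: subset_trans sZW. Qed.

Lemma vanish_on_closure e P Y :
  P \is e.-homog -> vanish_on P Y -> vanish_on P (zclosure Y).
Proof. by move=> /zclosed_vanishes cP h; apply: zclosure_min. Qed.

Lemma notin_zclosed C q : zclosed C -> ~ C q ->
  exists e P, [/\ P \is e.-homog, vanish_on P C & ~ vanishes_at P q].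
Proof.
move=> [S hS ->] /= nq; apply: contrapT => h; apply: nq => P SP.
have [e he] := hS P SP; apply: contrapT => nP; apply: h; exists e, P; split=> //.
by move=> r; apply.
Qed.

(** The closure is cut out by all forms vanishing on [Y], because a point outside a closed set is
    separated from it by a form. *)
Lemma zclosed_zclosure Y : zclosed (zclosure Y).
Proof.
exists [set P | (exists e, P \is e.-homog) /\ vanish_on P Y]; first by move=> P [].
apply/seteqP; split=> q /= h.
  by move=> P [[e hP] /(vanish_on_closure hP)]; apply.
move=> C [cC sYC]; apply: contrapT => nq.
have [e [P [hP hC hq]]] := notin_zclosed cC nq.
by apply: hq; apply: h; split; [exists e | apply: vanish_onS hC].
Qed.

(** Otherwise each [W i] has a form vanishing on it but not on [Z]. The product of these forms
    vanishes on [Y], hence on [Z], against primality. *)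
Lemma zirreducible_sub_union (I : eqType) (s : seq I) (W : I -> set (proj V)) Y Z :
  zirreducible Z -> Z `<=` zclosure Y -> (forall q, Y q -> exists2 i, i \in s & W i q) ->
  exists2 i, i \in s & Z `<=` zclosure (W i).
Proof.
move=> irr ZY YW; apply: contrapT => h.
have /choice[P hP] : forall i, exists P, (exists e, P \is e.-homog) /\
    (i \in s -> vanish_on P (W i) /\ ~ vanish_on P Z).
  move=> i; have [is_|_] := boolP (i \in s); last first.
    by exists 0; split=> //; exists 0%N; apply: rpred0.
  have nZ : ~ Z `<=` zclosure (W i) by move=> ZW; apply: h; exists i.
  have [q Zq nq] : exists2 q, Z q & ~ zclosure (W i) q.
    by apply: contrapT => h'; apply: nZ => q Zq; apply: contrapT => nq; apply: h'; exists q.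
  have [e [P [hP PW nP]]] := notin_zclosed (zclosed_zclosure _) nq.
  exists P; split=> [|_]; first by exists e.
  by split; [exact: (vanish_onS (@zclosure_sub _)) | move/(_ q Zq)].
have hP1 i : exists e, P i \is e.-homog by have [] := hP i.
have [e he] := dhomog_prod_ex s hP1.
have vY : vanish_on (\prod_(i <- s) P i) Y.
  move=> q /YW[i is_ Wq] v qv; have [_ /(_ is_)[PW _]] := hP i.
  by rewrite (big_rem i) //= mevalM (PW q Wq v qv) mul0r.
have [i is_] := zirreducible_prod irr hP1 (vanish_onS ZY (vanish_on_closure he vY)).
by have [_ /(_ is_)[_]] := hP i.
Qed.

Lemma zclosed_setT : zclosed (setT : set (proj V)).
Proof. by exists set0 => //; apply/seteqP; split=> // q _ P. Qed.

Lemma irred_chain_prefix Y k j (Z : nat -> set (proj V)) : (j <= k)%N ->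
  irred_chain Y k Z -> irred_chain Y j Z.
Proof.
move=> jk [h1 h2]; split=> i ij; first by apply: h1; apply: leq_trans jk.
by apply: h2; apply: leq_trans jk.
Qed.

Lemma irred_chain_mono Y k (Z : nat -> set (proj V)) i j : irred_chain Y k Z ->
  (i <= j <= k)%N -> Z i `<=` Z j.
Proof.
move=> [_ h]; elim: j => [|j IH] /andP[ij jk].
  by move: ij; rewrite leqn0 => /eqP->.
move: ij; rewrite leq_eqVlt => /orP[/eqP->//|ij].
apply: subset_trans (proj1 (h j jk)).
by apply: IH; rewrite -ltnS ij ltnW.
Qed.

Lemma irred_chain_separate Y k (Z : nat -> set (proj V)) : irred_chain Y k Z ->
  forall i, (i <= k)%N -> exists m P, [/\ P \is m.+1.-homog,
    ~ vanish_on P (Z i) & forall j, (j < i)%N -> vanish_on P (Z j)].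
Proof.
move=> ch [|i] ik; have [h1 h2] := ch.
  (* At the bottom of the chain, any coordinate that is nonzero at a point of [Z 0] will do. *)
  have [[[q Zq] _] _] := h1 0%N ik; have [v [v0 qE]] := ptP q.
  have [c hc] := vcoords_neq0 v0.
  have hX : ('X_c : {mpoly K[N]}) \is 1.-homog by rewrite dhomogX /= mdeg1.
  exists 0%N, 'X_c; split=> // /(_ q Zq).
  by rewrite qE => /(vanishes_ptE v0 hX) /eqP; rewrite mevalXU; apply/negP.
have [sZ nZ] := h2 i ik.
have [q Zq nq] : exists2 q, Z i.+1 q & ~ Z i q.
  by apply: contrapT => h; apply: nZ => q Zq; apply: contrapT => nq; apply: h; exists q.
have [irr [C cC ZE]] := h1 i (ltnW ik).
have Yq : Y q by have [_ [C' _ ZE']] := h1 _ ik; move: Zq; rewrite ZE' => -[].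
have [|[|m] [P [hP PC nP]]] := notin_zclosed (q := q) cC.
- by move=> Cq; apply: nq; rewrite ZE; split.
(* A constant vanishing on the nonempty set [Z i] is zero, so the separating form has positive
   degree. *)
- have /dhomogP hP0 := hP; exfalso.
  have PE : P = (P@_0%MM)%:MP.
    apply/mpolyP => m; rewrite mcoeffC; have [->|m0] := eqVneq m 0%MM; first by rewrite mulr1.
    by rewrite mulr0 (dhomog_nemf_coeff hP) //= mdeg_eq0.
  have PZ : vanish_on P (Z i) by apply: vanish_onS PC; rewrite ZE => ? [].
  move: PZ nP; rewrite PE => /(vanish_on_const irr.1) ->; apply=> v _.
  by rewrite mevalC.
exists m, P; split=> //; first by move/(_ q Zq).
move=> j ji; apply: vanish_onS PC; apply: (@subset_trans _ (Z i)); last by rewrite ZE => ? [].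
by apply: (irred_chain_mono ch); rewrite -ltnS ji ltnW.
Qed.

(** Says that the Hilbert function of [Z] in degree [e] is at least [t]. *)
Definition independent_mod Z e t := exists g : 'I_t -> {mpoly K[N]},
  (forall i, g i \is e.-homog) /\
  forall c : 'I_t -> K, vanish_on (\sum_i c i *: g i) Z -> forall i, c i = 0.

(** Multiples of [P] vanish on [W], so restriction to [W] isolates the second family; on the
    irreducible set [Z] the factor [P] can then be cancelled from the first. *)
Lemma independent_modD Z W e e' t t' P : zirreducible Z -> W `<=` Z ->
  P \is e'.-homog -> vanish_on P W -> ~ vanish_on P Z ->
  independent_mod Z e t -> independent_mod W (e' + e) t' ->
  independent_mod Z (e' + e) (t + t').
Proof.
move=> irr sWZ hP PW PZ [g [hg ig]] [h [hh ih]].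
exists (fun i => match split i with inl j => P * g j | inr j => h j end).
split=> [i|c]; first by case: split => j //; apply: dhomogM.
rewrite big_split_ord /=.
under eq_bigr => i _ do rewrite (unsplitK (inl i)) scalerAr.
under [X in _ + X]eq_bigr => i _ do rewrite (unsplitK (inr i)).
rewrite -mulr_sumr => H.
have c2 : forall j, c (rshift t j) = 0.
  apply: ih => q Wq v qv; have := H q (sWZ _ Wq) v qv.
  by rewrite mevalD mevalM (PW q Wq v qv) mul0r add0r.
have c1 : forall j, c (lshift t' j) = 0.
  apply: (ig (fun i => c (lshift t' i))).
  have hs : \sum_i c (lshift t' i) *: g i \is e.-homog.
    by apply: rpred_sum => i _; apply: rpredZ.
  suff /(zirreducible_prime irr hP hs)[/PZ[]|] : vanish_on (P * \sum_i c (lshift t' i) *: g i) Z by [].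
  move=> q Zq v qv; have := H q Zq v qv.
  rewrite mevalD [X in _ + X]raddf_sum [X in _ + X]big1 ?addr0 // => i _.
  by rewrite c2 scale0r raddf0.
by move=> i; rewrite -[i]splitK; case: split => j /=.
Qed.

(** Double induction along Pascal's rule: in degree [D (e+1)] on [Z_(j+1)], take the multiples by
    [Q_(j+1)] of the forms of degree [D e], together with forms that are independent on [Z_j]. *)
Lemma irred_chain_independent Y k (Z : nat -> set (proj V)) : irred_chain Y k Z ->
  exists2 D, (0 < D)%N & forall e, independent_mod (Z k) (D * e) 'C(e + k, k).
Proof.
move=> ch; have /choice[b /choice[P hP]] : forall i, exists m, exists P, (i <= k)%N ->
  [/\ P \is m.+1.-homog, ~ vanish_on P (Z i) & forall j, (j < i)%N -> vanish_on P (Z j)].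
  move=> i; have [ik|ik] := leqP i k; last by exists 0%N, 0.
  by have [m [P ?]] := irred_chain_separate ch ik; exists m, P.
(* A common multiple of the degrees of the separating forms, so that suitable powers [Q i] all have
   degree [D]. *)
pose D := (\prod_(i < k.+1) (b i).+1)%N; exists D; first by rewrite prodn_gt0.
have dvdD i : (i <= k)%N -> ((b i).+1 %| D)%N.
  by move=> ik; rewrite /D (bigD1 (Ordinal (ik : i < k.+1)%N)) //= dvdn_mulr.
have D0 : (0 < D)%N by rewrite prodn_gt0.
pose Q i := P i ^+ (D %/ (b i).+1).
have irr i : (i <= k)%N -> zirreducible (Z i) by case: ch => h _ /h[].
have hQ i : (i <= k)%N -> Q i \is D.-homog.
  move=> ik; have [hPi _ _] := hP i ik.
  by have := dhomogMn (D %/ (b i).+1) hPi; rewrite mulnC divnK ?dvdD.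
have nQ i : (i <= k)%N -> ~ vanish_on (Q i) (Z i).
  by move=> ik; have [hPi + _] := hP i ik; apply: contra_not; apply: zirreducible_exp hPi; apply: irr.
have vQ i j : (i <= k)%N -> (j < i)%N -> vanish_on (Q i) (Z j).
  move=> ik ji; have [hPi _ /(_ j ji) h] := hP i ik.
  rewrite /Q -(prednK (n := D %/ _)); last by rewrite divn_gt0 // dvdn_leq // dvdD.
  by rewrite exprS; apply: vanish_onM h.
suff H j : (j <= k)%N -> forall e, independent_mod (Z j) (D * e) 'C(e + j, j) by exact: H.
elim: j => [|j IH] jk e.
  rewrite bin0; exists (fun=> Q 0%N ^+ e); split=> [i|c]; first exact/dhomogMn/hQ.
  rewrite big_ord1 => h i; rewrite ord1; apply/eqP; apply: contrapT => /negP ci.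
  apply: (nQ 0%N) => //; apply: (zirreducible_exp (k := e)); [exact: irr|exact: hQ|].
  move=> q Zq v qv; have /eqP := h q Zq v qv.
  by rewrite mevalZ mulf_eq0 (negPf ci) => /eqP.
elim: e => [|e IHe].
  rewrite muln0 add0n binn; exists (fun=> 1); split=> [i|c]; first exact: dhomog1.
  rewrite big_ord1 => h i; rewrite ord1; apply: (vanish_on_const (irr _ jk).1).
  by move: h; rewrite -mul_mpolyC mulr1.
have -> : 'C(e.+1 + j.+1, j.+1) = ('C(e + j.+1, j.+1) + 'C(e.+1 + j, j))%N.
  by rewrite addSn binS addSnnS.
rewrite mulnS.
apply: (independent_modD (irr _ jk) _ (hQ _ jk)) IHe _.
- by apply: (irred_chain_mono ch); rewrite jk andbT; apply: leqnSn.
- exact: vQ.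
- exact: nQ.
- by rewrite -mulnS; apply: IH; apply: ltnW.
Qed.

End ProjectiveGeometry.

(** * Independent families *)

Section IndependentFamilies.
Local Open Scope ring_scope.
Context (K : fieldType).
Implicit Types (U : lmodType K) (V : vectType K).

Definition indep U m (y : 'I_m -> U) :=
  forall k : 'I_m -> K, \sum_i k i *: y i = 0 -> forall i, k i = 0.

Lemma indepP V m (y : 'I_m -> V) : indep y <-> free [tuple y i | i < m].
Proof.
split=> [h|/freeP h k yk]; last first.
  by apply: h; rewrite -[RHS]yk; apply: eq_bigr => i _; rewrite -tnth_nth tnth_mktuple.
apply/freeP => k yk; apply: h; rewrite -[RHS]yk; apply: eq_bigr => i _.
by rewrite -tnth_nth tnth_mktuple.
Qed.

Lemma indep_dim V m (y : 'I_m -> V) (T : {vspace V}) :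
  indep y -> (forall i, y i \in T) -> (m <= \dim T)%N.
Proof.
move=> /indepP; set X := mktuple y => fX h; have <- : size X = m by rewrite size_tuple.
rewrite -(eqP fX); apply/dimvS/span_subvP => _ /mapP[i _ ->].
exact: h.
Qed.

Lemma dependent_family V m (y : 'I_m -> V) (T : {vspace V}) :
  (\dim T < m)%N -> (forall i, y i \in T) ->
  exists2 k : 'I_m -> K, \sum_i k i *: y i = 0 & exists i, k i != 0.
Proof.
move=> Tm yT; apply: contrapT => h.
have : indep y.
  move=> k yk i; apply/eqP; apply: contrapT => /negP ki.
  by apply: h; exists k => //; exists i.
by move/indep_dim => /(_ T yT); rewrite leqNgt Tm.
Qed.

(** Turns independence into the nonvanishing of a determinant, a condition that is polynomial in the
    family. *)
Lemma indep_minor V m (y : 'I_m -> V) : indep y ->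
  exists f : 'I_m -> 'I_(\dim {:V}), \det (\matrix_(i, j) vcoords (y i) (f j)) != 0.
Proof.
move=> iy; pose A := \matrix_(c < \dim {:V}, i < m) vcoords (y i) c.
have fA : row_full A.
  rewrite /row_full -mxrank_tr; apply: inj_row_free => v vA.
  apply/rowP => i; rewrite mxE; apply: iy; apply: vcoords_eq0 => c.
  have := congr1 (fun M : 'rV_(_) => M 0 c) vA; rewrite !mxE => <-.
  rewrite /vcoords linear_sum; apply: eq_bigr => j _.
  by rewrite !mxE linearZ.
exists (fullrankfun fA); have := fullrowsub_unit fA.
rewrite -unitmx_tr unitmxE unitfE; congr (\det _ != 0).
by apply/matrixP=> i j; rewrite !mxE.
Qed.

Lemma minor_indep V m (y : 'I_m -> V) (f : 'I_m -> 'I_(\dim {:V})) :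
  \det (\matrix_(i, j) vcoords (y i) (f j)) != 0 -> indep y.
Proof.
rewrite -unitfE -unitmxE; set A := \matrix_(i, j) _ => uA k yk i.
suff : \row_i k i = 0 by move/rowP/(_ i); rewrite !mxE.
rewrite -[LHS](mulmxK uA) (_ : _ *m A = 0) ?mul0mx //.
apply/rowP => j; rewrite !mxE -[RHS](_ : vcoords (0 : V) (f j) = 0); last by rewrite /vcoords linear0.
rewrite -yk /vcoords linear_sum; apply: eq_bigr => a _.
by rewrite !mxE linearZ.
Qed.

Lemma indep1 U (y : 'I_1 -> U) : y ord0 != 0 -> indep y.
Proof.
move=> y0 k; rewrite big_ord1 => /eqP; rewrite scaler_eq0 (negPf y0) orbF => /eqP k0 i.
by rewrite [i]ord1.
Qed.

Lemma indep_prefix U m n (y : nat -> U) : (m <= n)%N ->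
  indep (fun i : 'I_n => y i) -> indep (fun i : 'I_m => y i).
Proof.
move=> mn iy k yk i; pose k' j := if insub j is Some j' then k j' else 0.
have k'E (j : 'I_m) : k' j = k j by rewrite /k' insubT //= => h; congr k; apply: val_inj.
rewrite -k'E; apply: (iy (fun j => k' j) _ (widen_ord mn i)); rewrite -[RHS]yk.
under [RHS]eq_bigr do rewrite -k'E.
rewrite [RHS](big_ord_widen_cond _ (fun=> true) (fun j => k' j *: y j) mn) [RHS]big_mkcond.
by apply: eq_bigr => j _ /=; case: ltnP => // mj; rewrite /k' insubF ?ltnNge ?mj ?scale0r.
Qed.

Lemma indep_cons V m (y : 'I_m -> V) y0 (T : {vspace V}) : indep y ->
  (forall i, y i \in T) -> y0 \notin T -> indep (fun i => oapp y y0 (unlift ord0 i)).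
Proof.
move=> iy yT y0T k; rewrite big_ord_recl unlift_none /=.
under eq_bigr do rewrite liftK /=; move=> yk.
have k0 : k ord0 = 0.
  apply/eqP; apply: contraNT y0T => k0; rewrite -[y0](scalerK k0); apply: memvZ.
  move/eqP: yk; rewrite addr_eq0 => /eqP ->; rewrite memvN.
  by apply: memv_suml => i _; apply: memvZ.
move: yk; rewrite k0 scale0r add0r => /iy h i.
by case: (unliftP ord0 i) => [j|] -> //; apply: h.
Qed.

(** The vector [f x] is completed by a basis of a complement of its line in [T], and each basis
    vector is lifted through [f]. Starting at [x] makes every initial span contain [x]. *)
Lemma indep_preimages U V (f : U -> V) (T : {vspace V}) (x : U) :
  f x != 0 -> f x \in T -> (forall y, y \in T -> exists u, f u = y) ->
  exists2 w : nat -> U, w 0%N = x & indep (fun i : 'I_(\dim T) => f (w i)).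
Proof.
move=> fx0 fxT hT; pose S := (T :\: <[f x]>)%VS.
have cT : (T :&: <[f x]> = <[f x]>)%VS by apply/capv_idPr; rewrite -memvE.
have /choice[g hg] : forall y, exists u, y \in T -> f u = y.
  by move=> y; have [/hT[u <-]|_] := boolP (y \in T); [exists u | exists 0].
have bT : basis_of T (f x :: vbasis S).
  rewrite basisEdim span_cons (span_basis (vbasisP S)) /= size_tuple.
  rewrite -{1}(addv_diff_cap T <[f x]>%VS) cT addvC subvv /=.
  by rewrite -(dimv_cap_compl T <[f x]>%VS) cT dim_vline fx0.
exists (fun i => nth 0 (x :: [seq g y | y <- vbasis S]) i) => //.
have sz : size (f x :: vbasis S) == \dim T.
  by rewrite -(vector.size_basis (X := in_tuple (f x :: vbasis S)) bT).
apply/indepP; set X := mktuple _; suff -> : X = Tuple sz by apply: basis_free bT.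
apply: eq_from_tnth => i; rewrite tnth_mktuple (tnth_nth 0) /=.
case: i => -[|i] //= ilt; have {}ilt : (i < size (vbasis S))%N by move: ilt; rewrite -(eqP sz).
rewrite (nth_map 0) // hg //; apply: (subvP (diffvSl T <[f x]>%VS)).
exact/vbasis_mem/mem_nth.
Qed.

End IndependentFamilies.

(** * Dimension of the image of a quadratic map *)

Section JacobianCriterion.
Local Open Scope ring_scope.
Context (K : fieldType) (charK0 : [pchar K] =i pred0).

(** Jacobian criterion, by induction on the degree: differentiating [Q(F) = 0] gives a vector of
    pulled back derivatives of [Q] killed by the Jacobian matrix, whose determinant is a nonzero
    polynomial. *)
Lemma comp_homog_inj n (F : n.-tuple {mpoly K[n]}) t :
  \det (\matrix_(i, c) (tnth F c)^`M(i).@[t]) != 0 ->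
  forall e (Q : {mpoly K[n]}), Q \is e.-homog -> Q \mPo F = 0 -> Q = 0.
Proof.
move=> detJ; pose J : 'M[{mpoly K[n]}]_n := \matrix_(c, i) (tnth F c)^`M(i).
have J0 : \det J != 0.
  apply: contraNneq detJ => J0; rewrite -det_tr.
  rewrite (_ : _^T = map_mx (meval t) J); last by apply/matrixP=> i c; rewrite !mxE.
  by rewrite det_map_mx J0 raddf0.
elim=> [|e IH] Q hQ QF.
  have QE : Q = (Q@_0%MM)%:MP.
    apply/mpolyP => m; rewrite mcoeffC; have [->|m0] := eqVneq m 0%MM; first by rewrite mulr1.
    by rewrite mulr0 (dhomog_nemf_coeff hQ) //= mdeg_eq0.
  by move: QF; rewrite QE comp_mpolyC.
apply: (mderiv0_dhomog charK0 hQ) => c; apply: IH; first exact: dhomog_mderiv.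
pose v := \row_c (Q^`M(c) \mPo F).
suff : v = 0 by move/rowP/(_ c); rewrite !mxE.
have vJ : v *m J = 0.
  apply/rowP => i; have := congr1 (mderiv i) QF; rewrite mderiv_comp raddf0 => h.
  rewrite [RHS]mxE; apply: etrans h; rewrite mxE.
  by apply: eq_bigr => a _; rewrite !mxE.
(* Multiplication by the adjugate replaces inverting the Jacobian matrix over the polynomial
   ring. *)
have := congr1 (mulmx^~ (\adj J)) vJ; rewrite -mulmxA mul_mx_adj mul0mx mul_mx_scalar.
move=> /rowP vd; apply/rowP => a; have /eqP := vd a; rewrite !mxE mulf_eq0 (negPf J0) /=.
by move/eqP.
Qed.

End JacobianCriterion.

(** * Quadratic maps: rank of the derivative and chains in the image *)

Section QuadraticMap.
Local Open Scope ring_scope.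
Local Open Scope classical_set_scope.
Context (K : fieldType) (charK0 : [pchar K] =i pred0).
Context (V : vectType K) (U : lmodType K) (B : U -> U -> V).
Hypotheses (linBr : forall u, linear (B u)) (linBl : forall v, linear (B^~ v)).
Local Notation N := (\dim {:V}).

Definition quad u := B u u.
Definition dquad u v := B u v + B v u.
Definition quad_image : set (proj V) :=
  [set q | exists u (u0 : quad u != 0), q = pt u0].

(** The vectors [w] are indexed by [nat], so that initial segments give a flag of subspaces. *)
Definition lincomb m (w : nat -> U) (t : 'I_m -> K) : U := \sum_(i < m) t i *: w i.

Lemma B_sumr u m w (t : 'I_m -> K) : B u (lincomb w t) = \sum_i t i *: B u (w i).
Proof.
have B0 : B u 0 = 0 by have := linBr u (-1) 0 0; rewrite scaleN1r oppr0 addr0 scaleN1r addNr.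
by rewrite /lincomb; elim/big_rec2: _ => // i y x _ <-; rewrite linBr.
Qed.

Lemma B_suml v m w (t : 'I_m -> K) : B (lincomb w t) v = \sum_i t i *: B (w i) v.
Proof.
have B0 : B 0 v = 0 by have := linBl v (-1) 0 0; rewrite /= scaleN1r oppr0 addr0 scaleN1r addNr.
by rewrite /lincomb; elim/big_rec2: _ => // i y x _ <-; rewrite linBl.
Qed.

Lemma dquad_diag u : dquad u u = quad u *+ 2.
Proof. by rewrite /dquad -mulr2n. Qed.

Lemma dquad_diag_eq0 u : (dquad u u == 0) = (quad u == 0).
Proof. by rewrite dquad_diag -scaler_nat scaler_eq0 (negPf (natr_neq0 charK0 1)). Qed.

Definition quad_poly m (w : nat -> U) : N.-tuple {mpoly K[m]} :=
  [tuple \sum_(i < m) \sum_(j < m) vcoords (B (w i) (w j)) c *: ('X_i * 'X_j) | c < N].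

Lemma quad_poly_homog m w c : tnth (quad_poly m w) c \is 2.-homog.
Proof.
rewrite tnth_mktuple; apply: rpred_sum => i _; apply: rpred_sum => j _.
apply: rpredZ; rewrite (_ : 2 = 1 + 1)%N //.
by apply: dhomogM; rewrite dhomogX /= mdeg1.
Qed.

Lemma vcoordsD (x y : V) c : vcoords (x + y) c = vcoords x c + vcoords y c.
Proof. by rewrite /vcoords linearD. Qed.

Lemma vcoords_sum (I : finType) (F : I -> V) c :
  vcoords (\sum_i F i) c = \sum_i vcoords (F i) c.
Proof. by rewrite /vcoords linear_sum. Qed.

Lemma meval_quad_poly m w c t :
  (tnth (quad_poly m w) c).@[t] = vcoords (quad (lincomb w t)) c.
Proof.
rewrite tnth_mktuple rmorph_sum /quad B_suml vcoords_sum; apply: eq_bigr => i _.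
rewrite rmorph_sum vcoordsZ B_sumr vcoords_sum mulr_sumr; apply: eq_bigr => j _.
by rewrite /= mevalZ rmorphM /= !mevalXU vcoordsZ mulrC mulrA.
Qed.

Lemma meval_mderiv_quad_poly m w c t i :
  (tnth (quad_poly m w) c)^`M(i).@[t] = vcoords (dquad (lincomb w t) (w i)) c.
Proof.
rewrite tnth_mktuple /dquad vcoordsD B_suml B_sumr !vcoords_sum.
have dX j : ('X_j : {mpoly K[m]})^`M(i) = (i == j)%:R.
  rewrite mderivX mnm1E eq_sym; case: eqVneq => [->|_]; last by rewrite scale0r.
  by rewrite scale1r -{1}[U_(j)%MM]add0m addmK mpolyX0.
have dsum (G : 'I_m -> {mpoly K[m]}) : (\sum_j G j)^`M(i) = \sum_j (G j)^`M(i).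
  exact: raddf_sum.
pose F (j k : 'I_m) := vcoords (B (w j) (w k)) c *
  ((i == j)%:R * t k + t j * (i == k)%:R).
transitivity (\sum_j \sum_k F j k).
  rewrite dsum rmorph_sum; apply: eq_bigr => j _.
  rewrite dsum rmorph_sum; apply: eq_bigr => k _.
  rewrite /= mderivZ mevalZ mderivM !dX rmorphD !rmorphM /= !mevalXU.
  by rewrite !rmorph_nat.
rewrite /F; under eq_bigr do under eq_bigr do rewrite mulrDr.
under eq_bigr do rewrite big_split; rewrite big_split addrC /=; congr (_ + _).
  rewrite (bigD1 i) //= [X in _ + X]big1 ?addr0 => [|j ji].
    by apply: eq_bigr => k _; rewrite eqxx mul1r vcoordsZ mulrC.
  by apply: big1 => k _; rewrite eq_sym (negPf ji) mul0r mulr0.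
apply: eq_bigr => j _; rewrite (bigD1 i) //= eqxx big1 ?addr0 => [|k ki].
  by rewrite mulr1 vcoordsZ mulrC.
by rewrite eq_sym (negPf ki) !mulr0.
Qed.

Lemma meval_pullback m w (P : {mpoly K[N]}) t :
  (P \mPo quad_poly m w).@[t] = P.@[vcoords (quad (lincomb w t))].
Proof. by rewrite comp_mpoly_meval; apply: meval_eq => c; apply: meval_quad_poly. Qed.

Lemma lincomb_extend m w (t : 'I_m -> K) s :
  lincomb w (extend_point t s) = lincomb w t + s *: w m.
Proof.
rewrite /lincomb big_ord_recr /= extend_point_max; congr (_ + _).
by apply: eq_bigr => i _; rewrite extend_point_widen.
Qed.

Lemma dquad_lincomb u m w (t : 'I_m -> K) :
  dquad u (lincomb w t) = \sum_i t i *: dquad u (w i).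
Proof.
rewrite /dquad B_sumr B_suml -big_split; apply: eq_bigr => i _.
by rewrite /= -scalerDr.
Qed.

(** Along the slice and one further direction [v], all Jacobian minors of size [r + 1] vanish by
    maximality. They yield a linear relation between the derivatives of the pullback of [P],
    transversal at [a], so [transversal_relation_eq0] applies. *)
Lemma maximal_slice : (exists u, quad u != 0) ->
  exists r (w : nat -> U), [/\ (0 < r)%N,
    indep (fun i : 'I_r => dquad (w 0%N) (w i)) &
    forall P : {mpoly K[N]}, (forall t : 'I_r -> K, P.@[vcoords (quad (lincomb w t))] = 0) ->
      forall u, P.@[vcoords (quad u)] = 0].
Proof.
move=> [u0 u0P].
pose jac_rank r := exists a (s : nat -> U), quad a != 0 /\ indep (fun i : 'I_r => dquad a (s i)).
have [r rP maxr] : exists2 r, jac_rank r & forall r', jac_rank r' -> (r' <= r)%N.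
  have ex : exists r, `[< jac_rank r >].
    exists 1%N; apply/asboolP; exists u0, (fun=> u0); split=> //.
    by apply: indep1; rewrite dquad_diag_eq0.
  have ub r : `[< jac_rank r >] -> (r <= N)%N.
    by move=> /asboolP[a [s [_ /indep_dim]]]; apply=> i; apply: memvf.
  case: (ex_maxnP ex ub) => r /asboolP rP maxr; exists r => // r' /asboolP; exact: maxr.
case: rP => a [s [a0 si]].
pose T := <<[tuple dquad a (s i) | i < r]>>%VS.
have sT (i : 'I_r) : dquad a (s i) \in T by apply/memv_span/map_f/mem_enum.
have dT : \dim T = r by have /indepP/eqP -> := si; rewrite size_tuple.
(* Otherwise [a] could be added to the [s i], giving rank [r + 1]. Hence the slice can be chosen
   with [w 0 = a]. *)
have aT : dquad a a \in T.
  apply: contrapT => /negP aT; suff : jac_rank r.+1 by move/maxr; rewrite ltnn.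
  exists a, (fun i => if i is j.+1 then s j else a); split=> //.
  rewrite (_ : (fun _ => _) = (fun i : 'I_r.+1 =>
    oapp (fun j : 'I_r => dquad a (s j)) (dquad a a) (unlift ord0 i))).
    exact: indep_cons si sT aT.
  apply/funext => i; by case: (unliftP ord0 i) => [j|] -> //; rewrite ?liftK ?unlift_none.
have Tpre y : y \in T -> exists u, dquad a u = y.
  move/coord_span => yE; exists (lincomb s (fun i => coord [tuple dquad a (s i) | i < r] i y)).
  rewrite dquad_lincomb [RHS]yE; apply: eq_bigr => i _.
  by rewrite -tnth_nth tnth_mktuple.
have [|w w0 wi] := indep_preimages _ aT Tpre; first by rewrite dquad_diag_eq0.
rewrite dT in wi.
have r0 : (0 < r)%N.
  apply: maxr; exists a, (fun=> a); split=> //.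
  by apply: indep1; rewrite dquad_diag_eq0.
exists r, w; split=> //; first by rewrite w0.
move=> P Pw v; pose w' i := if (i < r)%N then w i else v.
have w'E (i : 'I_r) : w' i = w i by rewrite /w' ltn_ord.
have w'v : w' r = v by rewrite /w' ltnn.
have lin_w' t x : lincomb w' (@extend_point K r t x) = lincomb w t + x *: v.
  rewrite lincomb_extend w'v; congr (_ + _); apply: eq_bigr => i _.
  by rewrite w'E.
pose F := quad_poly r.+1 w'.
suff g0 : P \mPo F = 0.
  have := meval_pullback w' P (@extend_point K r (fun=> 0) 1); rewrite g0 meval0 lin_w' scale1r.
  by rewrite /lincomb big1 ?add0r // => i _; rewrite scale0r.
pose e0 : 'I_r -> K := fun i => (val i == 0%N)%:R.
have lin_e0 : lincomb w e0 = a.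
  rewrite /lincomb (bigD1 (Ordinal r0)) //= scale1r w0 big1 ?addr0 // => i.
  by rewrite -val_eqE /e0 => /negPf ->; rewrite scale0r.
have [f fdet] := indep_minor wi.
(* The columns are the [r] coordinates of the nonzero minor at [a], followed by a varying coordinate
   [c]. *)
pose col c (j : 'I_r.+1) := oapp f c (unlift ord_max j).
pose M c : 'M[{mpoly K[r.+1]}]_r.+1 := \matrix_(i, j) (tnth F (col c j))^`M(i).
have [c0 c0P] := vcoords_neq0 a0.
have Fc0 : tnth F c0 != 0.
  apply: contraNneq c0P => Fc0.
  have := meval_quad_poly w' c0 (extend_point e0 0).
  by rewrite -/F Fc0 meval0 lin_w' scale0r addr0 lin_e0 => <-.
(* The rank is maximal only among points where [quad] is nonzero; the factor [tnth F c0] takes care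
   of the points where [quad] vanishes. *)
have M0 c : \det (M c) = 0.
  suff /eqP : \det (M c) * tnth F c0 = 0 by rewrite mulf_eq0 (negPf Fc0) orbF => /eqP.
  apply: (mpoly_eq0P charK0) => t; rewrite mevalM.
  have [u0'|u0'] := eqVneq (quad (lincomb w' t)) 0.
    by rewrite meval_quad_poly u0' /vcoords linear0 mulr0.
  apply/eqP; rewrite mulf_eq0; apply/orP; left; apply: contrapT => /negP dM.
  suff : jac_rank r.+1 by move/maxr; rewrite ltnn.
  exists (lincomb w' t), w'; split=> //; apply: (@minor_indep _ _ _ _ (col c)).
  move: dM; rewrite -det_map_mx; congr (\det _ != 0).
  by apply/matrixP=> i j; rewrite !mxE /= meval_mderiv_quad_poly.
(* These cofactors do not involve [c], so expanding [\det (M c)] along its last column gives the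
   same relation for every coordinate. *)
pose C i := cofactor (M c0) i ord_max.
have CE c i : cofactor (M c) i ord_max = C i.
  congr (_ * \det _); apply/matrixP=> x y; rewrite !mxE /col liftK //.
apply: (transversal_relation_eq0 charK0 (C := C)).
- under eq_bigr do rewrite mderiv_comp mulr_sumr.
  rewrite exchange_big big1 // => c _.
  under eq_bigr do rewrite mulrCA; rewrite -mulr_sumr.
  rewrite (_ : \sum_i _ = 0) ?mulr0 // -[RHS](M0 c) (expand_det_col _ ord_max).
  by apply: eq_bigr => i _; rewrite CE mulrC !mxE /col unlift_none.
- by move=> t; rewrite meval_pullback lin_w' scale0r addr0.
exists e0; rewrite mevalM mulf_neq0 //.
  by rewrite rmorph_sign signr_eq0.
rewrite -det_map_mx; move: fdet; congr (\det _ != 0).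
apply/matrixP=> i j; rewrite !mxE /= meval_mderiv_quad_poly lin_w' scale0r addr0 lin_e0.
by rewrite lift_max w'E /col liftK.
Qed.

Lemma vanish_on_quad_image e (P : {mpoly K[N]}) : P \is e.-homog ->
  vanish_on P quad_image <-> (forall u, quad u != 0 -> P.@[vcoords (quad u)] = 0).
Proof.
move=> hP; split=> [h u u0|h q [u [u0 ->]]]; last by apply/(vanishes_ptE u0 hP)/h.
by apply/(vanishes_ptE u0 hP)/h; exists u, u0.
Qed.

(** If the chain were too long, [bin_growth] would give more independent forms on it than there are
    forms of the pulled back degree on the maximal slice. A nontrivial combination would vanish on
    the slice, hence on the whole image. *)
Lemma irred_chain_length_lt Y k Z rho :
  irred_chain Y k Z -> Z k `<=` zclosure quad_image ->
  (forall u m (s : 'I_m -> U), indep (fun i => dquad u (s i)) -> (m <= rho)%N) ->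
  (k < rho)%N.
Proof.
move=> ch Zim rk; rewrite ltnNge; apply/negP => rho_k.
have irr i : (i <= k)%N -> zirreducible (Z i) by case: ch => h _ /h[].
(* If [quad] were zero everywhere, the constant 1 would vanish on the nonempty set [Z k]. *)
have ex : exists u, quad u != 0.
  apply: contrapT => h; have h1 : vanish_on 1 (Z k).
    apply: (vanish_onS Zim); apply: (vanish_on_closure (e := 0%N)); first exact: dhomog1.
    by move=> q [u [u0 _]]; case: h; exists u.
  move: h1; rewrite -mpolyC1 => /(vanish_on_const (irr k (leqnn k)).1)/eqP.
  by rewrite oner_eq0.
have [r' [w []]] := maximal_slice ex; case: r' => // r _ wi Pw.
have rk_k : (r.+1 <= k)%N by apply: leq_trans rho_k; apply: rk wi.
have [D D0 ind] := irred_chain_independent (irred_chain_prefix rk_k ch).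
have [e he] := bin_growth (2 * D)%N r; have [g [hg ig]] := ind e.
have hpull i : g i \mPo quad_poly r.+1 w \is (2 * D * e).-homog.
  by rewrite -mulnA; apply: (dhomog_comp (hg i)) => c; apply: quad_poly_homog.
have [||c cg [i ci]] := @dependent_family K (dhomog r.+1 K (2 * D * e)%N) _
  (fun i => DHomog (hpull i)) fullv.
- by rewrite dim_forms.
- by move=> i; apply: memvf.
case/eqP: ci; apply: ig => q Zq.
have hS : \sum_i c i *: g i \is (D * e).-homog by apply: rpred_sum => j _; apply: rpredZ.
have vS : vanish_on (\sum_i c i *: g i) quad_image.
  apply/(vanish_on_quad_image hS) => u _; apply: Pw => t; rewrite -meval_pullback.
  have -> : (\sum_i c i *: g i) \mPo quad_poly r.+1 w = 0; last by rewrite meval0.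
  have := congr1 (@mpoly_of_dhomog _ _ _) cg; rewrite raddf_sum /= => <-.
  by rewrite raddf_sum; apply: eq_bigr => j _; apply: comp_mpolyZ.
apply: (vanish_on_closure hS vS); apply: Zim.
by apply: (irred_chain_mono ch _ Zq); rewrite rk_k leqnn.
Qed.

(** Counting forms in [m + 2] suitable coordinates of [V] gives a nonzero one that pulls back to
    zero in [m + 1] parameters; with one more parameter the Jacobian criterion forbids this. *)
Lemma pullback_kernel_grows m w : indep (fun i : 'I_m.+2 => dquad (w 0%N) (w i)) ->
  exists e (P : {mpoly K[N]}), [/\ P \is e.-homog,
    forall t : 'I_m.+1 -> K, P.@[vcoords (quad (lincomb w t))] = 0 &
    exists t : 'I_m.+2 -> K, P.@[vcoords (quad (lincomb w t))] != 0].
Proof.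
move=> wi; have [f fdet] := indep_minor wi.
pose F n : (m.+2).-tuple {mpoly K[n]} := [tuple tnth (quad_poly n w) (f j) | j < m.+2].
have [e he] := bin_growth 2 m.
have hF n (Q : dhomog m.+2 K e) : val Q \mPo F n \is (2 * e).-homog.
  by apply: dhomog_comp (valP Q) _ => c; rewrite tnth_mktuple; apply: quad_poly_homog.
have [||c cF [i ci]] := @dependent_family K (dhomog m.+1 K (2 * e)%N) (\dim {:dhomog m.+2 K e})
  (fun i => DHomog (hF m.+1 (vbasis fullv)`_i)) fullv.
- by rewrite !dim_forms.
- by move=> i; apply: memvf.
pose Q : dhomog m.+2 K e := \sum_i c i *: (vbasis fullv)`_i.
have Q0 : Q != 0.
  apply: contraNneq ci => Q0; apply/eqP.
  by move/freeP: (basis_free (vbasisP {:dhomog m.+2 K e})); apply.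
have QF : val Q \mPo F m.+1 = 0.
  have := congr1 (@mpoly_of_dhomog _ _ _) cF; rewrite raddf_sum /= => <-.
  rewrite /Q raddf_sum raddf_sum; apply: eq_bigr => j _.
  exact: comp_mpolyZ.
pose P := val Q \mPo [tuple 'X_(f j) : {mpoly K[N]} | j < m.+2].
have PE n (t : 'I_n -> K) : P.@[vcoords (quad (lincomb w t))] = (val Q \mPo F n).@[t].
  rewrite !comp_mpoly_meval; apply: meval_eq => j.
  by rewrite tnth_mktuple mevalXU tnth_mktuple meval_quad_poly.
exists e, P; split.
- rewrite -[e]mul1n; apply: dhomog_comp (valP Q) _ => j.
  by rewrite tnth_mktuple dhomogX /= mdeg1.
- by move=> t; rewrite PE QF meval0.
apply: contrapT => h; case/eqP: Q0; apply: val_inj => /=.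
pose t0 : 'I_m.+2 -> K := fun i => (val i == 0%N)%:R.
have lin_t0 : lincomb w t0 = w 0%N.
  rewrite /lincomb big_ord_recl scale1r big1 ?addr0 // => i' _.
  by rewrite scale0r.
apply: (comp_homog_inj charK0 (F := F m.+2) (t := t0) _ (valP Q)).
  move: fdet; congr (\det _ != 0); apply/matrixP => x y.
  by rewrite !mxE tnth_mktuple meval_mderiv_quad_poly lin_t0.
apply: (mpoly_eq0P charK0) => t; rewrite -PE; apply/eqP; apply: contrapT => ht.
by apply: h; exists t; apply/negP.
Qed.

Lemma irred_chain_quad_image Y b (T : {vspace V}) :
  quad_image `<=` Y -> quad b != 0 -> dquad b b \in T ->
  (forall y, y \in T -> exists u, dquad b u = y) ->
  exists Z, irred_chain Y (\dim T).-1 Z.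
Proof.
move=> imY b0 bT hT.
have [||w w0 wi] := indep_preimages (x := b) _ _ hT.
- by rewrite dquad_diag_eq0.
- exact: bT.
have T0 : (0 < \dim T)%N.
  by rewrite lt0n dimv_eq0; apply: contraNneq b0 => T0; rewrite -dquad_diag_eq0 -memv0 -T0.
pose im m : set (proj V) := [set q | exists (t : 'I_m -> K) (t0 : quad (lincomb w t) != 0), q = pt t0].
have im_sub m : im m `<=` quad_image by move=> _ [t [t0 ->]]; exists (lincomb w t), t0.
have imS m : im m `<=` im m.+1.
  move=> _ [t [t0 ->]]; exists (extend_point t 0).
  have E : lincomb w (extend_point t 0) = lincomb w t by rewrite lincomb_extend scale0r addr0.
  have t0' : quad (lincomb w (extend_point t 0)) != 0 by rewrite E.
  by exists t0'; apply: val_inj; rewrite /= E.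
pose e0 m : 'I_m.+1 -> K := fun i => (val i == 0%N)%:R.
have lin_e0 m : lincomb w (e0 m) = b.
  by rewrite /lincomb big_ord_recl scale1r w0 big1 ?addr0 // => i _; rewrite scale0r.
have bim m : im m.+1 (pt b0).
  have e0' : quad (lincomb w (e0 m)) != 0 by rewrite lin_e0.
  by exists (e0 m), e0'; apply: val_inj; rewrite /= lin_e0.
have imYcl m : im m `<=` Y `&` zclosure (im m).
  by move=> q qm; split; [exact: imY (im_sub _ _ qm) | exact: zclosure_sub].
(* The shift by one makes [Z 0] come from the line of [b], and the last member from all [\dim T]
   directions. *)
exists (fun j => Y `&` zclosure (im j.+1)); split=> j jT.
  split; last by exists (zclosure (im j.+1)) => //; apply: zclosed_zclosure.
  split; first by exists (pt b0); apply/imYcl/bim.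
  (* The image is parametrised by an affine space: forms not vanishing on it have nonzero pullbacks,
     whose product is again nonzero. *)
  move=> C D cC cD sub.
  have nsub E : zclosed E -> ~ Y `&` zclosure (im j.+1) `<=` E ->
      exists P : {mpoly K[N]}, [/\ exists e, P \is e.-homog, vanish_on P E & P \mPo quad_poly j.+1 w != 0].
    move=> cE nE; have : ~ im j.+1 `<=` E.
      by move=> imE; apply: nE => q [_]; apply: zclosure_min.
    move=> nimE; have [q [t [t0 qE]] nq] : exists2 q, im j.+1 q & ~ E q.
      by apply: contrapT => h; apply: nimE => q hq; apply: contrapT => nq; apply: h; exists q.
    have [e [P [hP PE nP]]] := notin_zclosed cE nq; exists P; split=> //; first by exists e.
    apply: contra_not_neq nP => P0; rewrite qE; apply/(vanishes_ptE t0 hP).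
    by rewrite -meval_pullback P0 meval0.
  apply: contrapT => /not_orP[/(nsub _ cC)[P [[eP hP] PC P0]] /(nsub _ cD)[Q [[eQ hQ] QD Q0]]].
  have [c c0] := vcoords_neq0 b0.
  have F0 : tnth (quad_poly j.+1 w) c != 0.
    apply: contraNneq c0 => F0; have := meval_quad_poly w c (e0 j).
    by rewrite F0 meval0 lin_e0 => <-.
  (* The extra coordinate of [quad] in the product ensures that the parameter found defines a
     projective point. *)
  have [t] := mpoly_nonroot charK0 (mulf_neq0 F0 (mulf_neq0 P0 Q0)).
  rewrite !mevalM !mulf_eq0 !negb_or !meval_pullback meval_quad_poly => /and3P[t0 Pt Qt].
  have qt : quad (lincomb w t) != 0.
    by apply: contraNneq t0 => ->; rewrite /vcoords linear0.
  have /sub[/PC|/QD] : (Y `&` zclosure (im j.+1)) (pt qt) by apply: imYcl; exists t, qt.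
    by move/(vanishes_ptE qt hP)/eqP; apply/negP.
  by move/(vanishes_ptE qt hQ)/eqP; apply/negP.
split; first by move=> q [Yq hq]; split=> //; apply: zclosureS hq.
move=> sub; have jT2 : (j.+2 <= \dim T)%N by rewrite -(prednK T0).
have wi' : indep (fun i : 'I_j.+2 => dquad (w 0%N) (w i)).
  by rewrite w0; apply: (indep_prefix (y := fun i => dquad b (w i)) jT2).
have [e [P [hP Pj [t Pt]]]] := pullback_kernel_grows wi'.
have qt : quad (lincomb w t) != 0.
  apply: contraNneq Pt => ->; have := Pj (fun=> 0).
  rewrite /lincomb big1 => [|i _]; last by rewrite scale0r.
  have -> : quad 0 = 0 by have := linBr 0 (-1) 0 0; rewrite scaleN1r oppr0 addr0 scaleN1r addNr.
  by move=> ->.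
have vP : vanish_on P (zclosure (im j.+1)).
  apply: (vanish_on_closure hP) => _ [s [s0 ->]]; apply/(vanishes_ptE s0 hP); exact: Pj.
have [_ /vP] : (Y `&` zclosure (im j.+1)) (pt qt).
  by apply: sub; apply: imYcl; exists t, qt.
by move/(vanishes_ptE qt hP)/eqP; apply/negP.
Qed.

End QuadraticMap.

(** * Forms in the ideal of a deformed complete intersection *)

Section Pencils.
Local Open Scope ring_scope.
Context (K : fieldType) (charK0 : [pchar K] =i pred0) (V : vectType K).

Lemma horner_det_pencil m (A C : 'M[K]_m) s :
  (\det (map_mx polyC A + 'X *: map_mx polyC C)).[s] = \det (A + s *: C).
Proof.
rewrite -[LHS]/(horner_eval s _) -det_map_mx; congr (\det _).
by apply/matrixP => i j; rewrite !mxE /= /horner_eval hornerD hornerC hornerM hornerX hornerC.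
Qed.

(** A maximal minor of the family is a polynomial in [s] that is nonzero at [s = 0]. *)
Lemma pencil_indepr m (v w : 'I_m -> V) : indep v ->
  exists2 p : {poly K}, p != 0 & forall s, p.[s] != 0 -> indep (fun i => v i + s *: w i).
Proof.
move=> /indep_minor[f fdet].
pose M (y : 'I_m -> V) := \matrix_(i, j) vcoords (y i) (f j).
exists (\det (map_mx polyC (M v) + 'X *: map_mx polyC (M w))).
  apply: contraNneq fdet => p0; have := horner_det_pencil (M v) (M w) 0.
  by rewrite p0 horner0 scale0r addr0 => <-.
move=> s; rewrite horner_det_pencil => hs; apply: (@minor_indep _ _ _ _ f).
move: hs; congr (\det _ != 0); apply/matrixP => i j.
by rewrite !mxE vcoordsD vcoordsZ.
Qed.

Lemma pencil_indepl m (v w : 'I_m -> V) : indep v ->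
  exists2 p : {poly K}, p != 0 & forall s, p.[s] != 0 -> indep (fun i => s *: v i + w i).
Proof.
move=> /indep_minor[f fdet].
pose M (y : 'I_m -> V) := \matrix_(i, j) vcoords (y i) (f j).
exists (\det (map_mx polyC (M w) + 'X *: map_mx polyC (M v))).
  pose p := \det (map_mx polyC (M v) + 'X *: map_mx polyC (M w)).
  have p0 : p != 0.
    apply: contraNneq fdet => p0; have := horner_det_pencil (M v) (M w) 0.
    by rewrite -/p p0 horner0 scale0r addr0 => <-.
  (* For [s] nonzero, the two pencils at [s] and at [s^-1] differ by the factor [s], so the reversed
     determinant is nonzero at [s^-1]. *)
  have [s] : exists s, (p * 'X).[s] != 0.
    by apply: poly_nonroot => //; rewrite mulf_neq0 // polyX_eq0.
  rewrite hornerMX mulf_eq0 negb_or horner_det_pencil => /andP[ps s0].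
  apply: contraNneq ps => q0; have := horner_det_pencil (M w) (M v) s^-1.
  rewrite q0 horner0 => /esym d0.
  by rewrite -[M v](scalerKV s0) -scalerDr addrC detZ d0 mulr0.
move=> s; rewrite horner_det_pencil => hs; apply: (@minor_indep _ _ _ _ f).
move: hs; congr (\det _ != 0); apply/matrixP => i j.
by rewrite !mxE vcoordsD vcoordsZ addrC.
Qed.

End Pencils.

(** * Forms of a fixed degree and their monomial bases *)

Section Monomials.
Local Open Scope ring_scope.
Context (K : fieldType) (charK0 : [pchar K] =i pred0) (r : nat).
Local Notation R := {mpoly K[r.+1]}.

(** Taking the component of degree [d] is total and linear, so forms can be built from arbitrary
    polynomials without carrying degree proofs. *)
Definition hcomp d (p : R) : forms K r d := DHomog (pihomogP mdeg d p).

Lemma hcomp_is_linear d : linear (hcomp d).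
Proof. by move=> c p q; apply: val_inj; rewrite /= linearP. Qed.

HB.instance Definition _ d :=
  GRing.isLinear.Build K R (forms K r d) _ (hcomp d) (hcomp_is_linear d).

Lemma hcompK d (p : R) : p \is d.-homog -> val (hcomp d p) = p.
Proof. by move=> hp; rewrite /= pihomog_dE. Qed.

Lemma hcomp_val d (q : forms K r d) : hcomp d (val q) = q.
Proof. by apply: val_inj; rewrite hcompK //; apply: (valP q). Qed.

Definition mul_form d b (p : R) (q : forms K r b) : forms K r d := hcomp d (p * val q).

Lemma mul_form_is_linear d b p : linear (@mul_form d b p).
Proof.
move=> c q q'; rewrite /mul_form -[RHS]linearP; congr hcomp.
by rewrite /= mulrDr scalerAr.
Qed.

HB.instance Definition _ d b p :=
  GRing.isLinear.Build K (forms K r b) (forms K r d) _ (@mul_form d b p) (@mul_form_is_linear d b p).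

Definition multiples d b (p : R) : {vspace forms K r d} := limg (linfun (@mul_form d b p)).

Lemma dim_multiples d b p : (\dim (multiples d b p) <= 'C(b + r, r))%N.
Proof. by rewrite -(dim_forms K) -(limg_ker_dim (linfun (@mul_form d b p)) fullv) leq_addl. Qed.

Lemma multiplesP d b p y : reflect (exists q : forms K r b, y = hcomp d (p * val q)) (y \in multiples d b p).
Proof.
apply: (iffP memv_imgP) => [[q _ ->]|[q ->]]; exists q; rewrite ?lfunE ?memvf //.
Qed.

(** Bounded exponents provide a finite type in which monomials can be counted. *)
Definition degmons d (P : pred 'X_{1..r.+1}) : {set 'X_{1..r.+1 < d.+1}} :=
  [set m : 'X_{1..r.+1 < d.+1} | (mdeg m == d) && P m].

Definition degmon d (P : pred 'X_{1..r.+1}) (i : 'I_#|degmons d P|) : 'X_{1..r.+1} :=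
  enum_val i.

Lemma mdeg_degmon d P (i : 'I_#|degmons d P|) : mdeg (degmon i) = d.
Proof. by have := enum_valP i; rewrite inE => /andP[/eqP]. Qed.

Lemma degmonP d P (i : 'I_#|degmons d P|) : P (degmon i).
Proof. by have := enum_valP i; rewrite inE => /andP[]. Qed.

Lemma degmon_inj d P : injective (@degmon d P).
Proof. by move=> i j /val_inj/enum_val_inj. Qed.

Lemma degmon_surj d (P : pred 'X_{1..r.+1}) m : mdeg m = d -> P m -> exists i, @degmon d P i = m.
Proof.
move=> dm Pm; have lt : (mdeg m < d.+1)%N by rewrite dm.
have mD : BMultinom lt \in degmons d P by rewrite inE /= dm eqxx.
by exists (enum_rank_in mD (BMultinom lt)); rewrite /degmon enum_rankK_in.
Qed.

Lemma indep_degmons d P : indep (fun i : 'I_#|degmons d P| => hcomp d 'X_[K, degmon i]).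
Proof.
have hX (j : 'I_#|degmons d P|) : mpoly_of_dhomog (hcomp d 'X_[K, degmon j]) = 'X_[degmon j].
  by apply: hcompK; rewrite dhomogX /= mdeg_degmon eqxx.
move=> k /(congr1 (@mpoly_of_dhomog _ _ _)) + i; rewrite raddf_sum.
rewrite (eq_bigr (fun j => k j *: 'X_[degmon j])) => [|j _]; last exact: (congr1 ( *:%R (k j)) (hX j)).
move=> /(congr1 (mcoeff (degmon i))); rewrite raddf_sum mcoeff0.
rewrite (bigD1 i) //= [X in _ + X]big1 => [|j ji].
  by rewrite addr0 mcoeffZ mcoeffX eqxx mulr1.
by rewrite mcoeffZ mcoeffX (inj_eq (@degmon_inj _ _)) (negPf ji) mulr0.
Qed.

Lemma forms_monomials b (q : forms K r b) :
  val q = \sum_(m <- msupp (val q)) (val q)@_m *: 'X_[m] /\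
  {in msupp (val q), forall m, mdeg m = b}.
Proof. by split; [exact: mpolyE | exact/dhomogP/(valP q)]. Qed.

Lemma degmons_span d :
  <<[tuple hcomp d 'X_[K, degmon i] | i < #|degmons d predT|]>>%VS = fullv.
Proof.
apply/vspaceP => q; rewrite memvf; have [qE qm] := forms_monomials q.
rewrite -[q]hcomp_val qE linear_sum big_seq; apply: memv_suml => m mq.
rewrite linearZ /=; apply/memvZ/memv_span; have [i <-] := @degmon_surj d predT m (qm m mq) isT.
by apply: map_f; rewrite mem_enum.
Qed.

Lemma span_monomials d (y : 'I_#|degmons d predT| -> forms K r d) : indep y ->
  forall q, exists k, q = \sum_i k i *: y i.
Proof.
move=> iy q; have by_ : basis_of fullv [tuple y i | i < #|degmons d predT|].
  rewrite basisEfree subvf size_tuple -degmons_span (leq_trans (dim_span _)) ?size_tuple //.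
  by rewrite !andbT; apply/indepP.
have /coord_span qE : q \in <<[tuple y i | i < #|degmons d predT|]>>%VS.
  by rewrite (span_basis by_) memvf.
exists (fun i => coord [tuple y i | i < #|degmons d predT|] i q).
by rewrite [LHS]qE; apply: eq_bigr => i _; rewrite -tnth_nth tnth_mktuple.
Qed.

(** * Deformation to an ideal of powers of variables *)

Section CompleteIntersection.
Context (I : eqType) (x : I -> 'I_r.+1) (dl : I -> nat) (f : I -> R) (d : nat).
Hypotheses (hf : forall i, f i \is (dl i).-homog) (dl_le : forall i, (dl i <= d)%N).

(** Membership of the monomial [m] in the ideal generated by the powers [x_i^(dl i)], for [i] in
    [gs]. *)
Definition divisible_by (gs : seq I) (m : 'X_{1..r.+1}) := has (fun i => dl i <= m (x i))%N gs.

Definition deformed s i : R := f i + s *: 'X_[U_(x i) *+ dl i].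

Definition ideal_part s gs : {vspace forms K r d} :=
  (\sum_(i <- gs) multiples d (d - dl i) (deformed s i))%VS.

Lemma deformed_homog s i : deformed s i \is (dl i).-homog.
Proof. by apply: rpredD; [exact: hf | apply: rpredZ]; rewrite dhomogX /= mdegMn mdeg1 mul1n. Qed.

Lemma sub_ideal_part s gs i : i \in gs ->
  (multiples d (d - dl i) (deformed s i) <= ideal_part s gs)%VS.
Proof. by move=> ig; rewrite /ideal_part (big_rem i) //= addvSl. Qed.

(** Multiplication by [x_i^(dl i)] is injective on monomials and, as [x i] differs from the
    variables of [gs], keeps them outside the ideal of [gs]. The products are therefore new
    monomials in the larger ideal. *)
Lemma card_divisible_cons i gs : x i \notin [seq x j | j <- gs] ->
  (#|degmons d (divisible_by gs)| + #|degmons (d - dl i) (predC (divisible_by gs))| <=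
   #|degmons d (divisible_by (i :: gs))|)%N.
Proof.
move=> xi; pose sh (m : 'X_{1..r.+1}) := (m + U_(x i) *+ dl i)%MM.
have dv m : divisible_by gs (sh m) = divisible_by gs m.
  apply: eq_in_has => j jg; rewrite mnmDE mulmnE mnm1E.
  case: eqP => [xij|_]; last by rewrite mul0n addn0.
  by rewrite xij map_f in xi.
have shd (m : 'X_{1..r.+1 < (d - dl i).+1}) : mdeg m = (d - dl i)%N -> (mdeg (sh m) < d.+1)%N.
  by move=> dm; rewrite mdegD mdegMn mdeg1 mul1n dm subnK.
pose sh' (m : 'X_{1..r.+1 < (d - dl i).+1}) : 'X_{1..r.+1 < d.+1} := insubd bm0 (sh m).
have sh'E m : m \in degmons (d - dl i) (predC (divisible_by gs)) -> val (sh' m) = sh m.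
  by rewrite inE => /andP[/eqP dm _]; rewrite val_insubd shd.
have sh_inj : {in degmons (d - dl i) (predC (divisible_by gs)) &, injective sh'}.
  move=> m m' hm hm' /(congr1 val); rewrite !sh'E //.
  by move/addIm => e; apply: val_inj.
rewrite -(card_in_imset sh_inj) -cardsUI addnC.
rewrite (_ : _ :&: _ = finset.set0) ?cards0 ?add0n.
  apply/subset_leq_card/fintype.subsetP => m; rewrite inE => /orP[].
    by rewrite !inE /= => /andP[-> ->]; rewrite orbT.
  move=> /imsetP[m' hm' ->]; rewrite inE sh'E //; move: hm'; rewrite inE => /andP[/eqP dm _].
  by rewrite mdegD mdegMn mdeg1 mul1n dm subnK // eqxx /= mnmDE mulmnE mnm1E eqxx mul1n leq_addl.
apply/setP => m; rewrite !inE; apply/negP => /andP[/andP[_ dm] /imsetP[m' hm' mE]].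
move: dm; rewrite mE sh'E // dv; move: hm'; rewrite inE /= => /andP[_]; exact/negP.
Qed.

(* Modulo the other deformed generators, [s x_i^{dl i}] may be replaced by
   [- f_i].  Hence the multiples of the [j]-th generator by
   [s x_i^{dl i} m + f_i m] are redundant, and as [s] varies these span, together
   with the remaining monomials, for all but finitely many [s]. *)
Lemma dim_ideal_part gs : uniq [seq x i | i <- gs] ->
  exists2 p : {poly K}, p != 0 &
    forall s, p.[s] != 0 -> (\dim (ideal_part s gs) <= #|degmons d (divisible_by gs)|)%N.
Proof.
elim: gs => [|j gs IH] /=.
  by exists 1; rewrite ?oner_eq0 // => s _; rewrite /ideal_part big_nil dimv0.
move=> /andP[xj /IH[p p0 hp]].
pose b := (d - dl j)%N.
have ex (m : 'X_{1..r.+1}) : exists i, divisible_by gs m -> i \in gs /\ (dl i <= m (x i))%N.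
  have [/hasP[i ig im]|_] := boolP (divisible_by gs m); first by exists i.
  by exists j.
(* [sel m] is a generator whose power divides [m], and [red m] below is the quotient; when no power
   divides [m], the value is arbitrary. *)
have [sel selP] := choice ex.
pose red m := (m - U_(x (sel m)) *+ dl (sel m))%MM.
have redE m : divisible_by gs m -> (red m + U_(x (sel m)) *+ dl (sel m))%MM = m.
  move=> /selP[_ h]; apply: submK; apply/mnm_lepP => a; rewrite mulmnE mnm1E.
  by case: eqP => [<-|_]; rewrite ?mul1n ?mul0n.
pose th m : R := if divisible_by gs m then f (sel m) * 'X_[red m] else 0.
pose mon (i : 'I_#|degmons b predT|) := degmon i.
(* For almost all [s] the forms [s m + th m] are a basis in degree [b], since their leading parts in
   [s] are the monomials. *)
have [p' p'0 hp'] := pencil_indepl charK0 (fun i => hcomp b (th (mon i))) (indep_degmons (P := predT) (d := b)).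
exists (p * p'); first exact: mulf_neq0.
move=> s; rewrite hornerM mulf_eq0 negb_or => /andP[/hp dim_gs /hp' /span_monomials sp].
apply: leq_trans (card_divisible_cons xj).
pose std := [seq hcomp d (deformed s j * 'X_[degmon i]) |
  i : 'I_#|degmons b (predC (divisible_by gs))|].
have sub : (ideal_part s (j :: gs) <= ideal_part s gs + <<std>>)%VS.
  rewrite /ideal_part big_cons -/(ideal_part s gs) subv_add addvSl andbT.
  apply/subvP => _ /multiplesP[q ->]; have [k ->] := sp q.
  rewrite -/(mul_form d (deformed s j) _) linear_sum; apply: memv_suml => i _.
  rewrite linearZ /=; apply: memvZ; rewrite /mul_form.
  have dm : mdeg (mon i) = b by apply: mdeg_degmon.
  have dred : divisible_by gs (mon i) -> b = (dl (sel (mon i)) + mdeg (red (mon i)))%N.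
    by move=> hm; rewrite -dm -{1}(redE _ hm) mdegD mdegMn mdeg1 mul1n addnC.
  have -> : val (s *: hcomp b 'X_[mon i] + hcomp b (th (mon i))) = s *: 'X_[mon i] + th (mon i).
    rewrite -linearZ -linearD hcompK //; apply: rpredD.
      by apply: rpredZ; rewrite dhomogX /= dm.
    rewrite /th; case: ifP => [/dred ->|_]; last exact: rpred0.
    by apply: dhomogM; [exact: hf | rewrite dhomogX].
  rewrite /th; case: ifPn => [hm|hm].
    have [selg _] := selP _ hm; have e := redE _ hm.
    apply: (subvP (subv_trans (sub_ideal_part s selg) (addvSl _ _))).
    (* With [m' = red m] and [a = sel m], the product [deformed s j * (s m + f_a m')] equals
       [deformed s a * (deformed s j * m')], which already lies in the ideal of [gs]. *)
    apply/multiplesP; exists (hcomp _ (deformed s j * 'X_[red (mon i)])).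
    rewrite hcompK; last first.
      rewrite (_ : d - _ = dl j + mdeg (red (mon i)))%N; last first.
        have jd := dl_le j; rewrite -[in LHS](subnK jd) -/b (dred hm).
        by rewrite -addnA addKn addnC.
      by apply: dhomogM; [exact: deformed_homog | rewrite dhomogX].
    congr hcomp; rewrite mulrCA; congr (_ * _); rewrite /deformed mulrDl addrC; congr (_ + _).
    by rewrite -scalerAl -mpolyXD -{1}e addmC.
  rewrite addr0 -scalerAr linearZ; apply: memvZ; apply: (subvP (addvSr _ _)).
  have [a <-] : exists a, @degmon b (predC (divisible_by gs)) a = mon i.
    exact: degmon_surj.
  by apply/memv_span/map_f; rewrite mem_enum.
apply: leq_trans (dimvS sub) _; apply: leq_trans (dimv_add_leqif _ _) _.
apply: leq_add => //; apply: leq_trans (dim_span _) _.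
by rewrite size_map -cardE card_ord.
Qed.

End CompleteIntersection.
End Monomials.

(** * Sums of products of forms *)

Section SumsOfProducts.
Local Open Scope ring_scope.
Context (K : fieldType) (charK0 : [pchar K] =i pred0) (r d l : nat).
Local Notation R := {mpoly K[r.+1]}.
Local Notation I := ('I_l * bool)%type.
Local Notation U := {ffun I -> R}.

Section FixedType.
Context (k : 'I_l -> nat).

(* The index [(i, false)] stands for the factor [F_i] of degree [d - k i], and
   [(i, true)] for the factor [G_i] of degree [k i]. *)
Definition fdeg (p : I) : nat := if p.2 then k p.1 else (d - k p.1)%N.

(** A point is a family of arbitrary polynomials, projected here to the right degrees; the parameter
    space is thus one module for all types [k]. *)
Definition factor (u : U) (p : I) : R := pihomog mdeg (fdeg p) (u p).

Definition sum_products (u v : U) : forms K r d :=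
  hcomp d (\sum_i factor u (i, false) * factor v (i, true)).

Lemma factor_homog u p : factor u p \is (fdeg p).-homog.
Proof. exact: pihomogP. Qed.

Lemma factorP c u v p : factor (c *: u + v) p = c *: factor u p + factor v p.
Proof. by rewrite /factor !ffunE linearP. Qed.

Lemma sum_products_linr u : linear (sum_products u).
Proof.
move=> c v w; rewrite /sum_products -linearP; congr hcomp.
rewrite scaler_sumr -big_split; apply: eq_bigr => i _.
by rewrite factorP mulrDr scalerAr.
Qed.

Lemma sum_products_linl v : linear (sum_products^~ v).
Proof.
move=> c u w; rewrite /sum_products -linearP; congr hcomp.
rewrite scaler_sumr -big_split; apply: eq_bigr => i _.
by rewrite factorP mulrDl scalerAl.
Qed.

Hypothesis k_le : forall i, (k i <= d)%N.

Lemma fdegC p : fdeg (p.1, ~~ p.2) = (d - fdeg p)%N.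
Proof. by case: p => i [] //; rewrite /fdeg /= subKn ?k_le. Qed.

Lemma fdeg_le p : (fdeg p <= d)%N.
Proof. by case: p => i [] //; rewrite /fdeg /= ?leq_subr ?k_le. Qed.

(** The degree [d] part of the ideal of all factors; [dquad_tangent] and [tangent_dquad] identify it
    with the image of the derivative at [u]. *)
Definition tangent (u : U) : {vspace forms K r d} :=
  (\sum_(p : I) multiples d (d - fdeg p) (factor u p))%VS.

Lemma big_factors (T : Type) (idx : T) (op : Monoid.com_law idx) (F : I -> T) :
  \big[op/idx]_p F p = \big[op/idx]_i op (F (i, false)) (F (i, true)).
Proof.
rewrite (eq_bigr (fun p => F (p.1, p.2))) => [|[]//].
by rewrite -(pair_bigA _ (fun i b => F (i, b))) /=; apply: eq_bigr => i _; rewrite big_bool Monoid.mulmC.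
Qed.

Lemma dquad_tangent u v : dquad sum_products u v \in tangent u.
Proof.
have h p : hcomp d (factor u p * factor v (p.1, ~~ p.2)) \in tangent u.
  apply: (subvP (sumv_sup p _ (subvv _))) => //; apply/multiplesP.
  by exists (hcomp _ (factor v (p.1, ~~ p.2))); rewrite hcompK // -fdegC; apply: factor_homog.
rewrite /dquad /sum_products -linearD -big_split linear_sum; apply: memv_suml => i _ /=.
rewrite linearD; apply: memvD; first exact: (h (i, false)).
by rewrite mulrC; apply: (h (i, true)).
Qed.

Lemma tangent_dquad u y : y \in tangent u -> exists v, dquad sum_products u v = y.
Proof.
move=> /memv_sumP[z hz ->].
have /choice[q hq] : forall p, exists q : R, q \is (d - fdeg p).-homog /\ z p = hcomp d (factor u p * q).
  by move=> p; have /multiplesP[q ->] := hz p isT; exists (val q); split=> //; apply: (valP q).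
(* The multiplier of a factor is a variation of its partner, hence the flipped index. *)
pose v : U := [ffun p => q (p.1, ~~ p.2)].
have fv p : factor v (p.1, ~~ p.2) = q p.
  rewrite /factor ffunE /= negbK -surjective_pairing fdegC pihomog_dE //.
  by have [] := hq p.
exists v; rewrite /dquad /sum_products -linearD -big_split linear_sum big_factors.
apply: eq_bigr => i _ /=; rewrite linearD; congr (_ + _).
  by rewrite (fv (i, false)); have [_ ->] := hq (i, false).
by rewrite (fv (i, true)) mulrC; have [_ ->] := hq (i, true).
Qed.

Context (x : I -> 'I_r.+1).
Hypothesis (x_inj : injective x).

Definition monomial_point : U := [ffun p => 'X_[U_(x p) *+ fdeg p]].

Lemma factor_monomial_point p : factor monomial_point p = 'X_[U_(x p) *+ fdeg p].
Proof. by rewrite /factor ffunE pihomog_dE // dhomogX /= mdegMn mdeg1 mul1n. Qed.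

Lemma enum_x_uniq : uniq [seq x p | p <- enum {: I}].
Proof. by rewrite map_inj_uniq ?enum_uniq. Qed.

Definition rank_bound : nat := #|degmons d (divisible_by x fdeg (enum {: I}))|.

(** Along the pencil [t b + u] through the monomial point, independence persists for almost all [t],
    and for almost all [t] the tangent space has at most [rank_bound] dimensions; one [t] serves
    both. *)
Lemma jacobian_rank_le u m (s : 'I_m -> U) :
  indep (fun i => dquad sum_products u (s i)) -> (m <= rank_bound)%N.
Proof.
move=> is_; pose b := monomial_point.
have [p p0 hp] := pencil_indepr (fun i => dquad sum_products b (s i)) is_.
have [p' p'0 hp'] := dim_ideal_part charK0 (factor_homog u) fdeg_le enum_x_uniq.
have [t] := poly_nonroot charK0 (mulf_neq0 p0 p'0).
rewrite hornerM mulf_eq0 negb_or => /andP[/hp it /hp' dt].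
apply: leq_trans dt; apply: indep_dim it _ => i.
have -> : ideal_part x fdeg (factor u) d t (enum {: I}) = tangent (t *: b + u).
  rewrite /ideal_part /tangent big_enum; apply: eq_bigr => j _.
  by rewrite factorP factor_monomial_point addrC.
have -> : dquad sum_products u (s i) + t *: dquad sum_products b (s i) =
    dquad sum_products (t *: b + u) (s i).
  by rewrite /dquad sum_products_linl sum_products_linr /= scalerDr [LHS]addrC [LHS]addrACA.
exact: dquad_tangent.
Qed.

Lemma dim_tangent_monomial_point : (rank_bound <= \dim (tangent monomial_point))%N.
Proof.
apply: (indep_dim (@indep_degmons K r d _)) => i.
have /hasP[p _ hp] := degmonP i.
apply: (subvP (sumv_sup p _ (subvv _))) => //; apply/multiplesP.
pose m := (degmon i - U_(x p) *+ fdeg p)%MM.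
have e : (m + U_(x p) *+ fdeg p)%MM = degmon i.
  apply: submK; apply/mnm_lepP => a; rewrite mulmnE mnm1E.
  by case: eqP => [<-|_]; rewrite ?mul1n ?mul0n.
have hm : ('X_[m] : R) \is (d - fdeg p).-homog.
  rewrite dhomogX /= -(mdeg_degmon i) -[in X in _ == X]e mdegD mdegMn mdeg1 mul1n addnK.
  by rewrite eqxx.
exists (hcomp _ 'X_[m]); rewrite (hcompK hm) factor_monomial_point.
by rewrite -mpolyXD addmC e.
Qed.

Lemma quad_monomial_point : (0 < l)%N -> quad sum_products monomial_point != 0.
Proof.
(* At the point with all coordinates 1 the sum of products takes the value [l], nonzero in
   characteristic 0. *)
move=> l0; apply/eqP => /(congr1 (fun q : forms K r d => (val q).@[fun=> 1])).
rewrite hcompK; last first.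
  apply: rpred_sum => i _.
  have := dhomogM (factor_homog monomial_point (i, false)) (factor_homog monomial_point (i, true)).
  by rewrite /fdeg /= subnK ?k_le.
rewrite raddf0 raddf_sum (eq_bigr (fun=> 1)) => [|i _].
  rewrite sumr_const card_ord; case: l l0 => // l' _ /eqP.
  by rewrite (negPf (natr_neq0 charK0 l')).
rewrite !factor_monomial_point /= rmorphM /= !mevalX !big1 ?mulr1 // => *;
  by rewrite expr1n.
Qed.

End FixedType.
End SumsOfProducts.

(** * Comparison of the rank bounds of different types *)

Section RankBounds.
Local Open Scope ring_scope.
Context (K : fieldType) (r d l : nat).
Local Notation R := {mpoly K[r.+1]}.
Local Notation I := ('I_l * bool)%type.

Lemma card_degmonsC (P : pred 'X_{1..r.+1}) :
  (#|degmons d P| + #|degmons d (predC P)| = #|@degmons r d predT|)%N.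
Proof.
rewrite -[RHS](cardsID (degmons d P)); congr (_ + _)%N; apply: eq_card => m; rewrite !inE andbT.
  by case: (mdeg m == d).
by case: (mdeg m == d); rewrite ?andbT ?andbF.
Qed.

Lemma card_degmonsT : #|@degmons r d predT| = 'C(d + r, r).
Proof.
apply/eqP; rewrite eqn_leq -(dim_forms K) -{2}degmons_span.
rewrite (leq_trans (dim_span _)) ?size_tuple // andbT.
by apply: (indep_dim (@indep_degmons K r d predT)) => i; apply: memvf.
Qed.

Context (x : I -> 'I_r.+1) (x_inj : injective x).

Lemma sum_mnmE (c : 'I_l -> nat) b y :
  (\sum_i U_(x (i, b)) *+ c i)%MM y = (\sum_i (x (i, b) == y) * c i)%N.
Proof. by rewrite mnm_sumE; apply: eq_bigr => i _; rewrite mulmnE mnm1E. Qed.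

Lemma sum_mnm_x (c : 'I_l -> nat) b p :
  (\sum_i U_(x (i, b)) *+ c i)%MM (x p) = if p.2 == b then c p.1 else 0%N.
Proof.
rewrite sum_mnmE; case: p => j b' /=; case: eqP => [->|nb].
  rewrite (bigD1 j) //= eqxx mul1n big1 ?addn0 // => i ij.
  by rewrite (inj_eq x_inj) xpair_eqE (negPf ij).
rewrite big1 // => i _; rewrite (inj_eq x_inj) xpair_eqE; case: eqP => //= _.
by case: eqP => // e; case: nb.
Qed.

Lemma sum_mnm_notin (c : 'I_l -> nat) b y :
  (forall p, x p != y) -> (\sum_i U_(x (i, b)) *+ c i)%MM y = 0%N.
Proof. by move=> ny; rewrite sum_mnmE big1 // => i _; rewrite (negPf (ny _)). Qed.

(* The Hilbert function of [K[y, z]/(y^k, z^(d-k))] dominates that of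
   [K[y, z]/(y, z^(d-1))]: a power of [z] that is too large is traded for
   powers of [y]. *)
Lemma rank_bound_le (k : 'I_l -> nat) : (forall i, (0 < k i < d)%N) ->
  (rank_bound d k x <= rank_bound d (fun=> 1%N) x)%N.
Proof.
move=> kd; rewrite -(leq_add2r #|degmons d (predC (divisible_by x (fdeg d (fun=> 1%N)) (enum {: I})))|).
rewrite card_degmonsC -(card_degmonsC (divisible_by x (fdeg d k) (enum {: I}))) leq_add2l.
(* Standard monomials are compared instead. [psi] caps the exponent of [x (i, false)] at
   [d - k i - 1] and moves the excess [c m i], which is less than [k i], to the variable
   [x (i, true)], absent from [m]; both exponents together determine [m]. *)
pose c (m : 'X_{1..r.+1}) i := (m (x (i, false)) - (d - k i).-1)%N.
pose E m := (\sum_i U_(x (i, false)) *+ c m i)%MM.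
pose E' m := (\sum_i U_(x (i, true)) *+ c m i)%MM.
pose psi m := (m - E m + E' m)%MM.
pose N1 := degmons d (predC (divisible_by x (fdeg d (fun=> 1%N)) (enum {: I}))).
have N1P (m : 'X_{1..r.+1 < d.+1}) : m \in N1 ->
    [/\ mdeg m = d, forall i, m (x (i, false)) < d.-1 & forall i, m (x (i, true)) = 0]%N.
  rewrite inE => /andP[/eqP dm /hasPn h]; split=> // i.
    by have := h (i, false) (mem_enum _ _); rewrite -ltnNge /fdeg /= subn1.
  by have := h (i, true) (mem_enum _ _); rewrite -ltnNge /fdeg /= ltnS leqn0 => /eqP.
have leE m : (E m <= m)%MM.
  apply/mnm_lepP => y; have [[p <-]|ny] := pselect (exists p, x p = y).
    by rewrite sum_mnm_x; case: p => i [] //=; rewrite /c leq_subr.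
  by rewrite sum_mnm_notin // => p; apply: contra_not_neq ny => <-; exists p.
have mdE m : mdeg (psi m) = mdeg m.
  rewrite -[in RHS](submK (leE m)) /psi !mdegD; congr (_ + _)%N.
  by rewrite /E /E' !mdeg_sum; apply: eq_bigr => i _; rewrite !mdegMn !mdeg1.
have psi_f m i : psi m (x (i, false)) = minn (m (x (i, false))) (d - k i).-1.
  by rewrite mnmDE mnmBE !sum_mnm_x /= /c addn0; lia.
have psi_t (m : 'X_{1..r.+1}) i : m (x (i, true)) = 0%N -> psi m (x (i, true)) = c m i.
  by move=> m0; rewrite mnmDE mnmBE !sum_mnm_x /= m0.
have psi_o (m : 'X_{1..r.+1}) y : (forall p, x p != y) -> psi m y = m y.
  by move=> ny; rewrite mnmDE mnmBE !sum_mnm_notin // subn0 addn0.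
pose psi' (m : 'X_{1..r.+1 < d.+1}) : 'X_{1..r.+1 < d.+1} := insubd m (psi m).
have psi'E m : val (psi' m) = psi m by rewrite val_insubd mdE bmdeg.
rewrite -(card_in_imset (f := psi') (D := N1)).
  apply/subset_leq_card/fintype.subsetP => _ /imsetP[m /N1P[dm m1 m2] ->].
  rewrite inE psi'E mdE dm eqxx /=; apply/hasPn => -[i []] _; rewrite -ltnNge /fdeg /=.
    by rewrite psi_t // /c; have := m1 i; have := kd i; lia.
  by rewrite psi_f; have := kd i; lia.
move=> m m' /N1P[_ m1 m2] /N1P[_ m1' m2'] /(congr1 val); rewrite !psi'E => e.
apply/val_inj/mnmP => y; have [[[i [] <-]]|ny] := pselect (exists p, x p = y).
- by rewrite m2 m2'.
- have /mnmP/(_ (x (i, false))) := e; have /mnmP/(_ (x (i, true))) := e.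
  by rewrite !psi_f !psi_t // /c /=; lia.
have ny' p : x p != y by apply: contra_not_neq ny => <-; exists p.
by have /mnmP/(_ y) := e; rewrite !psi_o.
Qed.

End RankBounds.

(** * Dimension estimates for tangent spaces *)

Section TangentDimension.
Local Open Scope ring_scope.
Context (K : fieldType) (r d l : nat).
Local Notation R := {mpoly K[r.+1]}.
Local Notation I := ('I_l * bool)%type.

(* One more than the dimension of the affine cone over [X_{r,[d-k,k]}]. *)
Definition type_dim k := ('C(k + r, r) + 'C(d - k + r, r))%N.

Lemma bin_lt m n s : (0 < s <= m.+1)%N -> (m < n)%N -> ('C(m, s) < 'C(n, s))%N.
Proof.
case: s => // s; rewrite ltnS => /= sm mn; apply: leq_trans (leq_bin2l _ mn).
by rewrite binS -addn1 leq_add2l bin_gt0.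
Qed.

(** By Pascal's rule, passing from [k] to [k + 1] gains ['C(k + r, r - 1)] and loses
    ['C(d - k - 1 + r, r - 1)], which is larger as [k < d - k - 1]. *)
Lemma type_dim_decreasing k : (1 < r)%N -> (k.+1 <= d./2)%N -> (type_dim k.+1 < type_dim k)%N.
Proof.
rewrite /type_dim; case: r => [|[|s]] // _ kd.
have -> : (d - k)%N = (d - k.+1).+1 by lia.
rewrite !addSn !binS.
have : ('C(k + s.+2, s.+1) < 'C(d - k.+1 + s.+2, s.+1))%N by apply: bin_lt; lia.
lia.
Qed.

Lemma type_dim_lt k : (1 < r)%N -> (1 < k <= d./2)%N -> (type_dim k < type_dim 1)%N.
Proof.
move=> r1; elim: k => // k IH /andP[k1 kd].
apply: leq_trans (type_dim_decreasing r1 kd) _.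
move: k1; rewrite ltnS leq_eqVlt => /orP[/eqP<-//|k1].
by apply/ltnW/IH; rewrite k1 ltnW.
Qed.

Lemma type_dim1 : (0 < d)%N -> type_dim 1 = ('C(d.-1 + r, r) + r).+1.
Proof. by move=> d0; rewrite /type_dim add1n binSn subn1; lia. Qed.

Context (k : 'I_l -> nat) (u : {ffun I -> R}).
Hypothesis (k_bounds : forall i, (1 <= k i <= d./2)%N).

Definition factor_multiples p : {vspace forms K r d} := multiples d (d - fdeg d k p) (factor d k u p).
Definition pair_multiples i := (factor_multiples (i, false) + factor_multiples (i, true))%VS.

Lemma tangent_pairs : tangent d k u = (\sum_i pair_multiples i)%VS.
Proof. exact: big_factors. Qed.

Lemma multiples0 b : multiples d b (0 : R) = 0%VS.
Proof.
apply/eqP; rewrite -subv0; apply/subvP => _ /multiplesP[q ->].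
by rewrite mul0r linear0 mem0v.
Qed.

Lemma mem_multiples b e (p q : R) : p \is b.-homog -> q \is e.-homog -> (b + e)%N = d ->
  hcomp d (p * q) \in multiples d (d - b) p.
Proof.
move=> hp hq <-; rewrite addKn; apply/multiplesP.
by exists (hcomp e q); rewrite hcompK.
Qed.

Lemma hcomp_neq0 (p : R) : p \is d.-homog -> p != 0 -> hcomp d p != 0.
Proof. by move=> hp; apply: contra_neq => /(congr1 val); rewrite hcompK. Qed.

Lemma dimv_add_lt (V : vectType K) (W1 W2 : {vspace V}) z :
  z != 0 -> z \in W1 -> z \in W2 -> (\dim (W1 + W2)%VS < \dim W1 + \dim W2)%N.
Proof.
move=> z0 z1 z2; rewrite -dimv_sum_cap -addn1 leq_add2l lt0n dimv_eq0.
by apply: contraNneq z0 => W0; rewrite -memv0 -W0 memv_cap z1.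
Qed.

Lemma dim_factor_multiples_false i : (\dim (factor_multiples (i, false)) <= 'C(k i + r, r))%N.
Proof.
have -> : 'C(k i + r, r) = 'C(d - fdeg d k (i, false) + r, r).
  by congr 'C(_ + _, _); rewrite /fdeg /=; have := k_bounds i; lia.
exact: dim_multiples.
Qed.

Lemma dim_factor_multiples_true i : (\dim (factor_multiples (i, true)) <= 'C(d - k i + r, r))%N.
Proof. exact: dim_multiples. Qed.

(** The product of the two factors lies in both summands; if one factor is zero, its summand
    vanishes and the other alone is too small. *)
Lemma dim_pair_multiples i : (\dim (pair_multiples i) < type_dim (k i))%N.
Proof.
have h1 := dim_factor_multiples_false i; have h2 := dim_factor_multiples_true i.
have p1 : (0 < 'C(k i + r, r))%N by rewrite bin_gt0 leq_addl.
have p2 : (0 < 'C(d - k i + r, r))%N by rewrite bin_gt0 leq_addl.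
have [F0|F0] := eqVneq (factor d k u (i, false)) 0.
  rewrite /pair_multiples {1}/factor_multiples F0 multiples0 add0v /type_dim; lia.
have [G0|G0] := eqVneq (factor d k u (i, true)) 0.
  rewrite /pair_multiples {2}/factor_multiples G0 multiples0 addv0 /type_dim; lia.
apply: leq_trans (leq_add h1 h2).
have hF := factor_homog d k u (i, false); have hG := factor_homog d k u (i, true).
have dFG : (fdeg d k (i, false) + fdeg d k (i, true))%N = d.
  by rewrite /fdeg /=; have := k_bounds i; lia.
apply: (dimv_add_lt (z := hcomp d (factor d k u (i, false) * factor d k u (i, true)))).
- apply: hcomp_neq0; last exact: mulf_neq0.
  by have := dhomogM hF hG; rewrite dFG.
- exact: mem_multiples hF hG dFG.
by rewrite mulrC; apply: mem_multiples hG hF _; rewrite addnC.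
Qed.

Lemma dim_pair_multiples_le i : (1 < r)%N -> (1 < d)%N ->
  (\dim (pair_multiples i) <= 'C(d.-1 + r, r) + r)%N.
Proof.
move=> r1 d1; rewrite -ltnS -type_dim1; last lia.
apply: leq_trans (dim_pair_multiples i) _.
have /andP[] := k_bounds i; rewrite leq_eqVlt => /orP[/eqP<-//|k1 kd].
by apply/ltnW/type_dim_lt; rewrite // k1.
Qed.

(** The form [G_i G_j x_0^(d-2)] lies in both pairs, unless a linear factor is zero, in which case
    its pair is itself smaller. *)
Lemma dim_two_linear i j : (1 < r)%N -> (1 < d)%N -> i != j -> k i = 1%N -> k j = 1%N ->
  (\dim (pair_multiples i + pair_multiples j)%VS < ('C(d.-1 + r, r) + r).*2)%N.
Proof.
move=> r1 d1 ij ki kj.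
have small a : k a = 1%N -> factor d k u (a, true) = 0 ->
    (\dim (pair_multiples a) < 'C(d.-1 + r, r) + r)%N.
  move=> ka G0; rewrite /pair_multiples {2}/factor_multiples G0 multiples0 addv0.
  apply: leq_ltn_trans (dim_factor_multiples_false a) _; rewrite ka add1n binSn.
  rewrite -[X in (X < _)%N]add1n ltn_add2r.
  have : ('C(r, r) < 'C(d.-1 + r, r))%N by apply: bin_lt; lia.
  by rewrite binn.
have hi := dim_pair_multiples_le i r1 d1; have hj := dim_pair_multiples_le j r1 d1.
have hs := dimv_add_leqif (pair_multiples i) (pair_multiples j).
have [Gi|Gi] := eqVneq (factor d k u (i, true)) 0.
  by have := small i ki Gi; have := leq_of_leqif hs; lia.
have [Gj|Gj] := eqVneq (factor d k u (j, true)) 0.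
  by have := small j kj Gj; have := leq_of_leqif hs; lia.
pose M : R := 'X_[U_(ord0) *+ d.-2].
have hM : M \is (d.-2).-homog by rewrite dhomogX /= mdegMn mdeg1 mul1n.
have hGi : factor d k u (i, true) \is 1.-homog.
  by have := factor_homog d k u (i, true); rewrite /fdeg /= ki.
have hGj : factor d k u (j, true) \is 1.-homog.
  by have := factor_homog d k u (j, true); rewrite /fdeg /= kj.
have M0 : M != 0 by rewrite -msupp_eq0 msuppX.
suff : (\dim (pair_multiples i + pair_multiples j)%VS <
        \dim (pair_multiples i) + \dim (pair_multiples j))%N by lia.
apply: (dimv_add_lt (z := hcomp d (factor d k u (i, true) * (factor d k u (j, true) * M)))).
- apply: hcomp_neq0; last by rewrite !mulf_neq0.
  have := dhomogM hGi (dhomogM hGj hM); rewrite (_ : 1 + (1 + d.-2) = d)%N //; lia.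
- apply: (subvP (addvSr _ _)); rewrite /factor_multiples {1}/fdeg /= ki.
  by apply: mem_multiples hGi (dhomogM hGj hM) _; lia.
apply: (subvP (addvSr _ _)); rewrite /factor_multiples {1}/fdeg /= kj.
by rewrite mulrCA; apply: mem_multiples hGj (dhomogM hGi hM) _; lia.
Qed.

Lemma dim_sum_pairs (P : pred 'I_l) : (1 < r)%N -> (1 < d)%N ->
  (\dim (\sum_(i | P i) pair_multiples i)%VS <= #|P| * ('C(d.-1 + r, r) + r))%N.
Proof.
move=> r1 d1; rewrite -sum_nat_const.
elim/big_ind2: _ => [|W1 a W2 b h1 h2|i _]; first by rewrite dimv0.
  exact: leq_trans (leq_of_leqif (dimv_add_leqif _ _)) (leq_add h1 h2).
exact: dim_pair_multiples_le.
Qed.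

(* Two linear factors [G_i], [G_j] have the Koszul relation
   [G_i G_j - G_j G_i = 0], and a type other than [d-1,1] has smaller dimension. *)
Lemma dim_tangent_lt : (1 < r)%N -> (1 < d)%N -> (1 < l)%N ->
  (\dim (tangent d k u) < l * ('C(d.-1 + r, r) + r))%N.
Proof.
move=> r1 d1 l1; rewrite tangent_pairs.
have [[i ki]|allk] := pselect (exists i, (1 < k i)%N).
  rewrite (bigD1 i) //=.
  have h := dim_sum_pairs (predC1 i) r1 d1; rewrite cardC1 card_ord in h.
  have hi : (\dim (pair_multiples i) < 'C(d.-1 + r, r) + r)%N.
    rewrite -ltnS -type_dim1; last lia.
    apply: leq_ltn_trans (dim_pair_multiples i) _; apply: type_dim_lt => //.
    by rewrite ki; have /andP[] := k_bounds i.
  have := leq_of_leqif (dimv_add_leqif (pair_multiples i) (\sum_(j | j != i) pair_multiples j)%VS).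
  have -> : (l * ('C(d.-1 + r, r) + r) = ('C(d.-1 + r, r) + r) + l.-1 * ('C(d.-1 + r, r) + r))%N.
    by rewrite -mulSn prednK //; lia.
  by move: h hi; set A := \dim _; set B := \dim _; set C := \dim _; lia.
have k1 i : k i = 1%N.
  have /andP[h _] := k_bounds i; apply/eqP; rewrite eqn_leq h andbT leqNgt.
  by apply/negP => h'; apply: allk; exists i.
pose i := Ordinal (ltnW l1 : (0 < l)%N); pose j := Ordinal l1.
have ij : j != i by [].
rewrite (bigD1 i) //= (bigD1 j) //= addvA.
have h := dim_sum_pairs (fun a => (a != i) && (a != j)) r1 d1.
have cardP : #|(fun a => (a != i) && (a != j)) : pred 'I_l| = l.-2.
  have e := cardD1 j (predC1 i); rewrite cardC1 card_ord inE /= add1n in e.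
  by rewrite e; apply: eq_card => a; rewrite !inE andbC.
rewrite cardP in h; have ji : i != j by [].
have hij := dim_two_linear r1 d1 ji (k1 i) (k1 j).
have := leq_of_leqif (dimv_add_leqif (pair_multiples i + pair_multiples j)
  (\sum_(a | (a != i) && (a != j)) pair_multiples a)%VS).
set M := ('C(_, _) + r)%N in h hij *; move: h hij.
set A := \dim _; set B := \dim _; set C := \dim _ => h hij hC.
have -> : (l * M = M.*2 + l.-2 * M)%N by rewrite -mul2n -mulnDl; congr muln; lia.
lia.
Qed.

End TangentDimension.

(** * Dimensions in projective space *)

Section Dimension.
Local Open Scope ring_scope.
Local Open Scope classical_set_scope.
Context (K : fieldType) (charK0 : [pchar K] =i pred0) (V : vectType K).
Local Notation N := (\dim {:V}).
Implicit Types (Y : set (proj V)) (Z : nat -> set (proj V)).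

Lemma has_dim_ge Y m k Z : has_dim Y m -> irred_chain Y k Z -> (k <= m)%N.
Proof. by move=> [_ h] /h. Qed.

Lemma has_dim_exists Y k0 Z0 n : irred_chain Y k0 Z0 ->
  (forall k Z, irred_chain Y k Z -> (k < n)%N) ->
  exists m, [/\ has_dim Y m, (k0 <= m)%N & (m < n)%N].
Proof.
move=> ch0 bound; pose P k := `[< exists Z, irred_chain Y k Z >].
have exP : exists k, P k by exists k0; apply/asboolP; exists Z0.
have ubP k : P k -> (k <= n)%N by move=> /asboolP[Z /bound/ltnW].
case: (ex_maxnP exP ubP) => m /asboolP[Z chZ] maxm; exists m; split.
- by split; [exists Z | move=> k Z' chZ'; apply: maxm; apply/asboolP; exists Z'].
- by apply: maxm; apply/asboolP; exists Z0.
exact: bound chZ.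
Qed.

(** The quadratic map [(c, v) |-> c v] has the whole projective space as image, so the results on
    quadratic maps apply to [P(V)] itself. *)
Definition scaling (u v : K^o * V) : V := u.1 *: v.2.

Lemma scaling_linr u : linear (scaling u).
Proof. by move=> c v w; rewrite /scaling /= scalerDr !scalerA mulrC. Qed.

Lemma scaling_linl v : linear (scaling^~ v).
Proof. by move=> c u w; rewrite /scaling /= scalerDl scalerA. Qed.

Lemma quad_image_scaling q : quad_image scaling q.
Proof.
have [v [v0 ->]] := ptP q; have E : quad scaling (1, v) = v by rewrite /quad /scaling scale1r.
have qv0 : quad scaling (1, v) != 0 by rewrite E.
by exists (1, v), qv0; apply: val_inj; rewrite /= E.
Qed.

Lemma irred_chain_lt_dim Y k Z : irred_chain Y k Z -> (k < N)%N.
Proof.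
move=> ch; apply: (irred_chain_length_lt charK0 scaling_linr scaling_linl ch).
  by move=> q _; exact: (zclosure_sub (quad_image_scaling q)).
by move=> u m s is_; apply: indep_dim is_ _ => i; apply: memvf.
Qed.

Lemma irred_chain_setT : (0 < N)%N -> exists Z, irred_chain (setT : set (proj V)) N.-1 Z.
Proof.
move=> N0; have v0 : vpick {:V} != 0 by rewrite vpick0 -dimv_eq0 -lt0n.
apply: (irred_chain_quad_image charK0 scaling_linr scaling_linl (b := (1, vpick {:V}))) => //.
- by rewrite /quad /scaling scale1r.
- exact: memvf.
move=> y _; exists (0, y); rewrite /dquad /scaling /=.
by rewrite scale1r scale0r addr0.
Qed.

Lemma zirreducible_setT : (0 < N)%N -> zirreducible (setT : set (proj V)).
Proof.
move=> N0; have v0 : vpick {:V} != 0 by rewrite vpick0 -dimv_eq0 -lt0n.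
split; first by exists (pt v0).
move=> C D cC cD sub; have nsub E : zclosed E -> ~ setT `<=` E ->
    exists e (P : {mpoly K[N]}), [/\ P \is e.-homog, vanish_on P E & P != 0].
  move=> cE nE; have [q nq] : exists q, ~ E q.
    by apply: contrapT => h; apply: nE => q _; apply: contrapT => nq; apply: h; exists q.
  have [e [P [hP PE nP]]] := notin_zclosed cE nq; exists e, P; split=> //.
  by apply: contra_not_neq nP => -> v _; rewrite meval0.
apply: contrapT => /not_orP[/(nsub _ cC)[eP [P [hP PC P0]]] /(nsub _ cD)[eQ [Q [hQ QD Q0]]]].
(* A coordinate is included in the product so that the nonroot is a nonzero vector. *)
have X0 : 'X_(Ordinal N0) != 0 :> {mpoly K[N]} by rewrite -msupp_eq0 msuppX.
have [t] := mpoly_nonroot charK0 (mulf_neq0 X0 (mulf_neq0 P0 Q0)).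
rewrite !mevalM !mulf_eq0 !negb_or mevalXU => /and3P[t0 Pt Qt].
pose v : V := \sum_i t i *: (vbasis {:V})`_i.
have vt : vcoords v =1 t by move=> i; rewrite /vcoords coord_sum_free // (basis_free (vbasisP _)).
have vn0 : v != 0.
  by apply: contraNneq t0 => v0'; rewrite -vt v0' /vcoords linear0.
case: (sub (pt vn0) I) => [/PC|/QD].
  by move/(vanishes_ptE vn0 hP)/eqP; rewrite (meval_eq _ vt); apply/negP.
by move/(vanishes_ptE vn0 hQ)/eqP; rewrite (meval_eq _ vt); apply/negP.
Qed.

(** The whole space, being irreducible, can be added on top of a chain in a proper closed subset. *)
Lemma irred_chain_proper Y m Z : zclosed Y -> Y <> setT -> irred_chain Y m Z -> (m.+1 < N)%N.
Proof.
move=> cY nY ch; have N0 : (0 < N)%N by apply: leq_ltn_trans (irred_chain_lt_dim ch).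
have [h1 h2] := ch.
apply: (@irred_chain_lt_dim setT _ (fun i => if (i <= m)%N then Z i else setT)).
split=> i im; last first.
  rewrite -ltnS im; case: ltnP => im'; first exact: h2.
  split=> // sub; apply: nY; apply/seteqP; split=> // q _.
  have [_ [C _ ZE]] := h1 i im; have : Z i q by apply: sub.
  by rewrite ZE => -[].
case: leqP => im'; last first.
  split; first exact: zirreducible_setT.
  by exists setT; [exact: zclosed_setT | rewrite setTI].
have [irr [C cC ZE]] := h1 i im'; split=> //; exists (Z i); last by rewrite setTI.
rewrite ZE; have <- : zclosure (Y `&` C) = Y `&` C; last exact: zclosed_zclosure.
apply/seteqP; split; last exact: zclosure_sub.
by move=> q hq; split; apply: hq; split=> // ? [].
Qed.

(* Coincident or vanishing summands are replaced by further points of [X]. *)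
Lemma mem_lin_spans l (X : set (proj V)) (g : nat -> proj V) (v : 'I_l -> V) q :
  injective g -> (forall i, X (g i)) ->
  (forall i (vi0 : v i != 0), X (pt vi0)) ->
  val q = <[\sum_i v i]>%VS -> lin_spans l X q.
Proof.
move=> g_inj gX vX qE; suff [p [p_inj pX vp]] : exists p : 'I_l -> proj V,
    [/\ injective p, forall i, X (p i) & \sum_i v i \in (\sum_(i < l) val (p i))%VS].
  by exists p; split; rewrite // qE -memvE.
elim: l v vX {qE} => [|l IH] v vX.
  by exists (fun i => g i); split=> [[]//|[]//|]; rewrite !big_ord0 mem0v.
have [p [p_inj pX vp]] := IH (fun i => v (widen_ord (leqnSn l) i)) (fun i => vX _).
have [q' [q'X q'p vq']] : exists q', [/\ X q', forall i, p i <> q' &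
    v ord_max \in (\sum_(i < l) val (p i) + val q')%VS].
  (* By pigeonhole, one of [l + 1] distinct points [g i] is not among the [l] points [p j]. *)
  have new : exists q', X q' /\ forall i, p i <> q'.
    apply: contrapT => h; have /choice[h' hh'] : forall i : 'I_l.+1, exists j, p j = g i.
      move=> i; apply: contrapT => hi; apply: h; exists (g i); split=> // j pj.
      by apply: hi; exists j.
    have h'inj : injective h'.
      by move=> i j e; apply: val_inj; apply: g_inj; rewrite -!hh' e.
    by have := leq_card h' h'inj; rewrite !card_ord ltnn.
  have [v0|v0] := eqVneq (v ord_max) 0.
    by have [q' [q'X q'p]] := new; exists q'; split; rewrite // v0 mem0v.
  have [[i pi]|np] := pselect (exists i, p i = pt v0).
    have [q' [q'X q'p]] := new; exists q'; split=> //.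
    apply: (subvP (addvSl _ _)); apply: (subvP (sumv_sup i _ (subvv _))) => //.
    by rewrite pi /= memv_line.
  exists (pt v0); split=> [|i pi|]; [exact: vX | by apply: np; exists i|].
  by apply: (subvP (addvSr _ _)); rewrite /= memv_line.
exists (fun i => oapp p q' (unlift ord_max i)); split.
- move=> i j; case: (unliftP ord_max i) => [i'|] ->; case: (unliftP ord_max j) => [j'|] -> //=.
  + by move/p_inj->.
  + by move=> e; case: (q'p i').
  by move=> e; case: (q'p j').
- by move=> i; case: (unliftP ord_max i) => [i'|] _ /=.
have wl (i : 'I_l) : widen_ord (leqnSn l) i = lift ord_max i.
  exact/val_inj/esym/lift_max.
have E : (\sum_(i < l) val (oapp p q' (unlift ord_max (widen_ord (leqnSn l) i))) =
    \sum_(i < l) val (p i))%VS.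
  by apply: eq_bigr => i _; rewrite wl liftK.
rewrite !big_ord_recr /= unlift_none /= E.
by apply: memvD => //; apply: (subvP (addvSl _ _)).
Qed.

End Dimension.

(** * Secants of reducible forms *)

Section ReducibleForms.
Local Open Scope ring_scope.
Local Open Scope classical_set_scope.
Context (K : fieldType) (charK0 : [pchar K] =i pred0) (r d : nat).
Local Notation R := {mpoly K[r.+1]}.
Local Notation sums l k := (@sum_products K r d l k).
Local Notation N := (\dim {:forms K r d}).

Lemma mem_reducible_type k (F G : R) (FG0 : hcomp d (F * G) != 0) : (k <= d)%N ->
  F \is (d - k).-homog -> G \is k.-homog -> reducible_type K r d k (pt FG0).
Proof.
move=> kd hF hG; have hFG : F * G \is d.-homog by have := dhomogM hF hG; rewrite subnK.
have FG : F * G != 0 by apply: contraNneq FG0 => ->; rewrite linear0.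
have /norP[F0 G0] : ~~ ((F == 0) || (G == 0)) by rewrite -mulf_eq0.
exists (hcomp _ F), (hcomp _ G), (hcomp d (F * G)); split=> //.
- by apply: contraNneq F0 => /(congr1 val); rewrite hcompK // => ->.
- by apply: contraNneq G0 => /(congr1 val); rewrite hcompK // => ->.
by rewrite !(hcompK hF, hcompK hG, hcompK hFG).
Qed.

Lemma reducible_typeP k q : (k <= d)%N -> reducible_type K r d k q ->
  exists F G : R, [/\ F \is (d - k).-homog, G \is k.-homog & val q = <[hcomp d (F * G)]>%VS].
Proof.
move=> kd [F [G [H [_ _ HE ->]]]]; exists F, G; split; [exact: (valP F)|exact: (valP G)|].
by rewrite -HE (hcomp_val H).
Qed.

Lemma reducible_type_sub : (1 < d)%N -> reducible_type K r d 1 `<=` reducible_forms K r d.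
Proof. by move=> d1 q hq; exists 1%N => //=; lia. Qed.

Lemma lin_spans_sums l q : lin_spans l (reducible_forms K r d) q ->
  exists k : 'I_l -> nat, (forall i, (1 <= k i <= d./2)%N) /\ quad_image (sums l k) q.
Proof.
move=> [p [_ pX]]; have [v [v0 ->]] := ptP q; rewrite /= -memvE => /memv_sumP[w hw vE].
have /choice[k /choice[F /choice[G FG]]] : forall i, exists k, exists F : R, exists G : R,
    [/\ (1 <= k <= d./2)%N, F \is (d - k).-homog, G \is k.-homog & w i = hcomp d (F * G)].
  move=> i; have [k kd] := pX i; have kd' : (k <= d)%N by move: kd => /=; lia.
  move/(reducible_typeP kd') => [F [G [hF hG pE]]].
  (* The coefficient [c] is absorbed into the second factor. *)
  have := hw i isT; rewrite pE => /vlineP[c ->]; exists k, F, (c *: G); split=> //.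
    exact: rpredZ.
  by rewrite -scalerAr linearZ.
exists k; split=> [i|]; first by have [] := FG i.
pose u : {ffun 'I_l * bool -> R} := [ffun p => if p.2 then G p.1 else F p.1].
have uE : quad (sums l k) u = v.
  rewrite /quad /sum_products linear_sum vE; apply: eq_bigr => i _.
  have [_ hF hG ->] := FG i; congr hcomp.
  by rewrite /factor !ffunE /= !pihomog_dE.
have u0 : quad (sums l k) u != 0 by rewrite uE.
by exists u, u0; apply: val_inj; rewrite /= uE.
Qed.

(** Supplies infinitely many distinct points of type [[d-1,1]], as the points spanning a secant
    space must be distinct. *)
Definition pencil_form (c : nat) : R :=
  'X_[U_(ord0) *+ d.-1] * ('X_ord0 + c%:R *: 'X_(inord 1)).

Definition pencil_pt (a : K) (i : 'I_r.+1) : K := if i == ord0 then 1 else a.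

Lemma pencil_form_homog c : pencil_form c \is (d.-1 + 1).-homog.
Proof.
apply: dhomogM; first by rewrite dhomogX /= mdegMn mdeg1 mul1n.
by apply: rpredD; [|apply: rpredZ]; rewrite dhomogX /= mdeg1.
Qed.

Lemma meval_pencil_form c a : (0 < r)%N -> (pencil_form c).@[pencil_pt a] = 1 + c%:R * a.
Proof.
move=> r0; have n10 : (inord 1 == ord0 :> 'I_r.+1) = false by rewrite -val_eqE /= inordK.
rewrite mevalM mevalD mevalZ !mevalXU /pencil_pt eqxx n10 mevalX.
rewrite (bigD1 ord0) //= big1 ?mulr1 ?expr1n ?mul1r // => i i0.
by rewrite mulmnE mnm1E [ord0 == i]eq_sym (negPf i0) mul0n expr0.
Qed.

Lemma sums_lin_spans l : (1 < d)%N -> (0 < r)%N ->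
  quad_image (sums l (fun=> 1%N)) `<=` lin_spans l (reducible_type K r d 1).
Proof.
move=> d1 r0 _ [u [u0 ->]].
have d1' : (d.-1 + 1)%N = d by lia.
have hP c : pencil_form c \is d.-homog by have := pencil_form_homog c; rewrite d1'.
have P0 c : hcomp d (pencil_form c) != 0.
  apply/eqP => /(congr1 (fun q : forms K r d => (val q).@[pencil_pt 0])).
  by rewrite hcompK // meval_pencil_form // mulr0 addr0 raddf0 => /eqP; rewrite oner_eq0.
apply: (mem_lin_spans (g := fun c => pt (P0 c))
  (v := fun i => hcomp d (factor d (fun=> 1%N) u (i, false) * factor d (fun=> 1%N) u (i, true)))).
- move=> c c' /(congr1 val) /= e.
  have /vlineP[z zE] : hcomp d (pencil_form c) \in <[hcomp d (pencil_form c')]>%VS.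
    by rewrite -e memv_line.
  have zE' : pencil_form c = z *: pencil_form c'.
    by rewrite -(hcompK (hP c)) zE -[in RHS](hcompK (hP c')).
  (* The parameter [a = 0] gives [z = 1], and [a = 1] then gives [c = c']. *)
  have ev a : 1 + c%:R * a = z * (1 + c'%:R * a).
    by rewrite -!meval_pencil_form // zE' mevalZ.
  have z1 : z = 1 by have := ev 0; rewrite !mulr0 !addr0 mulr1 => <-.
  have := ev 1; rewrite z1 !mulr1 mul1r => /addrI; exact: natr_inj_pchar0.
- move=> c; apply: mem_reducible_type; first exact: ltnW.
    by rewrite dhomogX /= mdegMn mdeg1 mul1n subn1.
  by apply: rpredD; [|apply: rpredZ]; rewrite dhomogX /= mdeg1.
- move=> i vi0; apply: mem_reducible_type; first exact: ltnW.
    exact: (factor_homog d (fun=> 1%N) u (i, false)).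
  exact: (factor_homog d (fun=> 1%N) u (i, true)).
by rewrite /= /quad /sum_products linear_sum.
Qed.

Lemma sums_reducible_type : (1 < d)%N ->
  quad_image (sums 1 (fun=> 1%N)) `<=` reducible_type K r d 1.
Proof.
move=> d1 q [u [u0 ->]]; have E : quad (sums 1 (fun=> 1%N)) u =
    hcomp d (factor d (fun=> 1%N) u (ord0, false) * factor d (fun=> 1%N) u (ord0, true)).
  by rewrite /quad /sum_products big_ord1.
have h := u0; rewrite E in h.
have -> : pt u0 = pt h by apply: val_inj; rewrite /= E.
apply: mem_reducible_type; first exact: ltnW.
  exact: (factor_homog d (fun=> 1%N) u (ord0, false)).
exact: (factor_homog d (fun=> 1%N) u (ord0, true)).
Qed.

Lemma secantE l (X : set (proj (forms K r d))) : (l < N)%N -> secant l X = zclosure (lin_spans l X).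
Proof. by rewrite /secant ltnNge => /negPf ->. Qed.

(** The spans are covered by the images of finitely many types, and the irreducible set [Z k] lies
    in the closure of one of them. *)
Lemma secant_chain_type l X k Z : (l < N)%N -> X `<=` reducible_forms K r d ->
  irred_chain (secant l X) k Z ->
  exists t : 'I_l -> nat, (forall i, (1 <= t i <= d./2)%N) /\ Z k `<=` zclosure (quad_image (sums l t)).
Proof.
move=> lN sX ch; have [irr [C _ ZE]] := ch.1 k (leqnn k).
(* Types are encoded as finite functions so that they can be enumerated. *)
pose nat_of (t : {ffun 'I_l -> 'I_d.+1}) i : nat := t i.
pose W t : set (proj (forms K r d)) :=
  [set q | (forall i, (1 <= nat_of t i <= d./2)%N) /\ quad_image (sums l (nat_of t)) q].
have ZX : Z k `<=` zclosure (lin_spans l X) by rewrite ZE secantE // => q [].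
have [|t _ ZW] := zirreducible_sub_union (s := enum {: {ffun 'I_l -> 'I_d.+1}}) (W := W) irr ZX.
  move=> q [p [pinj pX hq]].
  have [|t [ht hq']] := @lin_spans_sums l q; first by exists p; split=> // i; apply: sX.
  exists [ffun i => inord (t i)]; rewrite ?mem_enum //.
  have -> : W [ffun i => inord (t i)] =
      [set q | (forall i, (1 <= t i <= d./2)%N) /\ quad_image (sums l t) q] => //.
  rewrite /W (_ : nat_of _ = t) //; apply/funext => i.
  by rewrite /nat_of ffunE inordK //; have := ht i; lia.
have [q Zq] := irr.1; have : W t !=set0.
  apply: contrapT => h; have h1 : vanish_on 1 (zclosure (W t)).
    apply: (vanish_on_closure (e := 0%N)); first exact: dhomog1.
    by move=> q' Wq'; case: h; exists q'.
  have := vanish_onS ZW h1; rewrite -mpolyC1 => /(vanish_on_const irr.1)/eqP.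
  by rewrite oner_eq0.
move=> [q' [ht _]]; exists (nat_of t); split=> //.
by apply: subset_trans ZW _; apply: zclosureS => ? [].
Qed.

End ReducibleForms.

(** * Dimension and defectiveness of secant varieties *)

Section SecantDimensions.
Local Open Scope ring_scope.
Local Open Scope classical_set_scope.
Context (K : fieldType) (charK0 : [pchar K] =i pred0) (r d : nat).
Hypotheses (r1 : (1 < r)%N) (d1 : (1 < d)%N).
Local Notation R := {mpoly K[r.+1]}.
Local Notation sums l k := (@sum_products K r d l k).
Local Notation N := (\dim {:forms K r d}).

Lemma card_linear_multiples (i : 'I_r.+1) :
  (r <= #|degmons 1 (fun m : 'X_{1..r.+1} => ~~ (0 < m i)%N)|)%N.
Proof.
have := card_degmonsC 1 (fun m : 'X_{1..r.+1} => 0 < m i)%N.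
have -> : #|@degmons r 1 predT| = r.+1 by rewrite (card_degmonsT K) add1n binSn.
move=> e; suff : (#|degmons 1 (fun m : 'X_{1..r.+1} => (0 < m i)%N)| <= 1)%N.
  by rewrite -(leq_add2r #|degmons 1 (predC (fun m : 'X_{1..r.+1} => (0 < m i)%N))|) e.
have U1 : (mdeg U_(i)%MM < 2)%N by rewrite mdeg1.
rewrite -[X in (_ <= X)%N](cards1 (BMultinom U1)); apply/subset_leq_card/fintype.subsetP => m.
rewrite !inE => /andP[/mdeg1P[j /eqP mE]]; rewrite mE mnm1E.
by case: eqP => // ji _; rewrite -val_eqE /= mE ji.
Qed.

(** The linear generator has ['C(d-1+r, r)] monomial multiples; the other, a power of exponent
    [d - 1], contributes its products with the [r] remaining variables. *)
Lemma rank_bound_one (x : 'I_1 * bool -> 'I_r.+1) : injective x ->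
  ('C(d.-1 + r, r) + r <= rank_bound d (fun=> 1%N) x)%N.
Proof.
move=> x_inj; pose k := fun _ : 'I_1 => 1%N.
have dl_le p : (fdeg d k p <= d)%N by apply: fdeg_le => i; apply: ltnW.
pose gs := [:: (ord0 : 'I_1, false); (ord0, true)].
have -> : rank_bound d (fun=> 1%N) x = #|degmons d (divisible_by x (fdeg d k) gs)|.
  apply: eq_card => m; rewrite !inE; congr (_ && _); apply: eq_has_r => -[i b].
  by rewrite mem_enum !inE [i]ord1; case: b.
have h1 := card_divisible_cons (x := x) dl_le (i := (ord0, true)) (gs := [::]) isT.
have h2 := card_divisible_cons (x := x) dl_le (i := (ord0, false)) (gs := [:: (ord0, true)]).
apply: leq_trans (h2 _); last by rewrite inE (inj_eq x_inj).
apply: leq_add; last first.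
  rewrite {1}/fdeg /= subKn ?(ltnW d1) //; apply: leq_trans (card_linear_multiples (x (ord0, true))) _.
  by apply/subset_leq_card/fintype.subsetP => m; rewrite !inE /= orbF.
apply: leq_trans h1; apply: leq_trans (leq_addl _ _); rewrite {1}/fdeg /= subn1.
rewrite -(card_degmonsT K).
by apply/subset_leq_card/fintype.subsetP => m; rewrite !inE /= andbT.
Qed.

Lemma tangent_chain l (k : 'I_l -> nat) (x : 'I_l * bool -> 'I_r.+1) (Y : set (proj (forms K r d))) :
  (0 < l)%N -> (forall i, (k i <= d)%N) -> quad_image (sums l k) `<=` Y ->
  exists Z, irred_chain Y (\dim (tangent d k (monomial_point K d k x))).-1 Z.
Proof.
move=> l0 kd sY.
apply: (irred_chain_quad_image charK0 (@sum_products_linr _ _ _ _ _) (@sum_products_linl _ _ _ _ _) sY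
  (b := monomial_point K d k x)).
- exact: quad_monomial_point.
- exact: dquad_tangent.
exact: tangent_dquad.
Qed.

Lemma quad_image_secant l X : quad_image (sums l (fun=> 1%N)) `<=` lin_spans l X ->
  (l < N)%N -> quad_image (sums l (fun=> 1%N)) `<=` secant l X.
Proof. by move=> sX lN; rewrite secantE //; apply: subset_trans sX (@zclosure_sub _ _ _). Qed.

Lemma lin_spansS l (X Y : set (proj (forms K r d))) : X `<=` Y -> lin_spans l X `<=` lin_spans l Y.
Proof. by move=> XY q [p [pinj pX hq]]; exists p; split=> // i; apply: XY. Qed.

Lemma dim_forms_gt0 : (0 < N)%N.
Proof. by rewrite dim_forms bin_gt0 leq_addl. Qed.

Lemma has_dim_setT : has_dim (setT : set (proj (forms K r d))) N.-1.
Proof.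
split; first exact: irred_chain_setT dim_forms_gt0.
by move=> k Z /(irred_chain_lt_dim charK0); case: N dim_forms_gt0.
Qed.

(** The value is the same for all [X] between type [[d-1,1]] and all reducible forms. The flag at
    the monomial point gives the lower bound; any chain lies in a single type, whose rank bound is
    largest when all degrees are 1. *)
Lemma has_dim_secant l (X : set (proj (forms K r d))) (x : 'I_l * bool -> 'I_r.+1) :
  (0 < l)%N -> (l < N)%N -> injective x ->
  reducible_type K r d 1 `<=` X -> X `<=` reducible_forms K r d ->
  has_dim (secant l X) (rank_bound d (fun=> 1%N) x).-1.
Proof.
move=> l0 lN x_inj X1 X2; split.
  have sX : quad_image (sums l (fun=> 1%N)) `<=` secant l X.
    apply: quad_image_secant => //; apply: subset_trans (sums_lin_spans charK0 d1 (ltnW r1)) _.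
    exact: lin_spansS.
  have k1 (i : 'I_l) : (1 <= d)%N by apply: ltnW.
  have [Z chZ] := tangent_chain x l0 k1 sX; exists Z; apply: irred_chain_prefix chZ.
  have := dim_tangent_monomial_point K d (fun=> 1%N) x.
  by set A := rank_bound _ _ _; set C := \dim _; case: A C => // ? [].
move=> k Z ch; have [t [ht Zt]] := secant_chain_type lN X2 ch.
have td i : (t i <= d)%N by have := ht i; lia.
have : (k < rank_bound d t x)%N.
  apply: (irred_chain_length_lt charK0 (@sum_products_linr _ _ _ _ _) (@sum_products_linl _ _ _ _ _) ch Zt).
  by move=> u m s; apply: jacobian_rank_le.
have : (rank_bound d t x <= rank_bound d (fun=> 1%N) x)%N.
  by apply: rank_bound_le => // i; have := ht i; lia.
by set A := rank_bound _ _ _; set C := rank_bound _ _ _; lia.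
Qed.

Lemma reducible_forms_chain :
  exists Z, irred_chain (reducible_forms K r d) ('C(d.-1 + r, r) + r).-1 Z.
Proof.
pose x (p : 'I_1 * bool) : 'I_r.+1 := if p.2 then ord0 else inord 1.
have x_inj : injective x.
  have n10 : (inord 1 == ord0 :> 'I_r.+1) = false by rewrite -val_eqE /= inordK // ltnW.
  move=> [i [|]] [j [|]] //; rewrite [i]ord1 [j]ord1 /x //= => /eqP; rewrite ?n10 //.
  by rewrite eq_sym n10.
have sX : quad_image (sums 1 (fun=> 1%N)) `<=` reducible_forms K r d.
  by move=> q /(sums_reducible_type d1); apply: reducible_type_sub.
have k1 (i : 'I_1) : (1 <= d)%N by apply: ltnW.
have [Z chZ] := tangent_chain x isT k1 sX; exists Z; apply: irred_chain_prefix chZ.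
have := leq_trans (rank_bound_one x_inj) (dim_tangent_monomial_point K d (fun=> 1%N) x).
by set C := \dim _; lia.
Qed.

Lemma secant_chain_length l k Z : (1 < l)%N -> (l < N)%N ->
  irred_chain (secant l (reducible_forms K r d)) k Z ->
  (k.+1 < l * ('C(d.-1 + r, r) + r))%N.
Proof.
move=> l1 lN ch; have [t [ht Zt]] := secant_chain_type lN (@subset_refl _ _) ch.
have td i : (t i <= d)%N by have := ht i; lia.
set M := (l * _)%N; have : (k < M.-1)%N; last lia.
apply: (irred_chain_length_lt charK0 (@sum_products_linr _ _ _ _ _) (@sum_products_linl _ _ _ _ _) ch Zt).
move=> u m s is_; have := dim_tangent_lt u ht r1 d1 l1.
have : (m <= \dim (tangent d t u))%N by apply: indep_dim is_ _ => i; apply: dquad_tangent.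
by rewrite /M; set C := \dim _; lia.
Qed.

(** A secant variety filling the space attains the largest possible expected dimension. A proper one
    has dimension below [N - 1] by [irred_chain_proper], and below [l (dim X + 1) - 1] by
    [secant_chain_length]. *)
Lemma secant_defectiveP l : (1 < l)%N ->
  secant_defective l (reducible_forms K r d) <-> secant l (reducible_forms K r d) <> setT.
Proof.
move=> l1; split=> [[e [s [_ hs se]]] sT|nT].
  have [Z chZ] := irred_chain_setT charK0 dim_forms_gt0.
  rewrite sT in hs; have := has_dim_ge hs chZ; move: se; rewrite /expected_dim leq_min.
  by move=> /andP[se _]; move: se; set A := N.-1; lia.
have lN : (l < N)%N.
  by rewrite ltnNge; apply/negP => Nl; apply: nT; rewrite /secant Nl.
have [Z0 ch0] := reducible_forms_chain.
have [|e [he eM _]] := has_dim_exists ch0 (n := N).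
  by move=> k Z; apply: irred_chain_lt_dim.
have cl : zclosed (secant l (reducible_forms K r d)).
  by rewrite secantE //; apply: zclosed_zclosure.
have sX : quad_image (sums l (fun=> 1%N)) `<=` secant l (reducible_forms K r d).
  apply: quad_image_secant => //; apply: subset_trans (sums_lin_spans charK0 d1 (ltnW r1)) _.
  exact/lin_spansS/reducible_type_sub.
have k1 (i : 'I_l) : (1 <= d)%N by apply: ltnW.
(* This chain only serves to show that the secant variety has a dimension. *)
have [Z1 ch1] := tangent_chain (fun=> ord0) (ltnW l1) k1 sX.
have [|s [hs _ _]] := has_dim_exists ch1 (n := N).
  by move=> k Z; apply: irred_chain_lt_dim.
exists e, s; split=> //; have [Z chZ] := hs.1.
have h1 := irred_chain_proper charK0 cl nT chZ; have h2 := secant_chain_length l1 lN chZ.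
rewrite /expected_dim leq_min; apply/andP; split; first by move: h1; set A := N; lia.
have : (l * ('C(d.-1 + r, r) + r) <= l * e.+1)%N by rewrite leq_mul2l; apply/orP; right; lia.
by move: h2; set A := (l * _)%N; lia.
Qed.

End SecantDimensions.

Theorem theorem1p5 (K : closedFieldType) (charK0 : [pchar K]%R =i pred0)
    (n d l : nat) (hn : (3 <= n)%N) (hd : (2 <= d)%N) (hl : (2 <= l)%N) :
  ((2 * l <= n)%N ->
     exists2 m : nat,
       has_dim (secant l (reducible_forms K n.-1 d)) m &
       has_dim (secant l (reducible_type K n.-1 d 1)) m)
  /\
  (secant_defective l (reducible_forms K n.-1 d) <->
     secant l (reducible_forms K n.-1 d) <> setT).
Proof.
case: n hn => // r r1; split=> /= [l2|]; last exact: secant_defectiveP.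
have [lN|Nl] := ltnP l (\dim {:forms K r d}); last first.
  exists (\dim {:forms K r d}).-1; rewrite /secant Nl; exact: has_dim_setT.
(* Since [2 l <= n], the [2 l] factors can be given distinct variables [x_(2i)] and [x_(2i+1)]. *)
pose x (p : 'I_l * bool) : 'I_r.+1 := inord (2 * p.1 + p.2).
have x_inj : injective x.
  have lt (p : 'I_l * bool) : (2 * p.1 + p.2 < r.+1)%N.
    by case: p => i [] /=; have := ltn_ord i; lia.
  move=> p q /(congr1 val); rewrite /= !inordK ?lt //.
  case: p q => i b [j c] /= e; suff [ij bc] : i = j :> nat /\ b = c by rewrite bc (val_inj ij).
  by move: e; case: b; case: c; lia.
have sub := @reducible_type_sub K r d hd.
exists (rank_bound d (fun=> 1) x).-1; apply: has_dim_secant => //; lia.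
Qed.
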